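(* Let $(\mathcal{E}_l)_{l\ge0}$ be a category of smooth objects over a field $K$, and let $\mathcal{E}_{n+m}$ have coordinates $(u,v)=(u_1,\ldots,u_n,v_1,\ldots,v_m)$. Let $\Delta\subset\mathbb{N}^n$ be a diagram of finite type with vertices $\alpha_1,\ldots,\alpha_k$ ordered reverse lexicographically, with associated sets $\Gamma$, $A_j$ and integer $d(\Delta)$. Let $f_1(u,v),\ldots,f_k(u,v)\in\mathcal{E}_{n+m}$ be functions in bijective correspondence $f_i\mapsto\alpha_i$ with the vertices, such that $\operatorname{ord}(f_i(u,0))=|\alpha_i|$. Assume that for all $s\leq d(\Delta)+1$ the generalized Jacobians $$J^s(f_1,\ldots,f_k:u^{\alpha_1},\ldots,u^{\alpha_k})\quad\text{and}\quad J^0_s(f_1,\ldots,f_k:u^{\alpha_1},\ldots,u^{\alpha_k})$$ are invertible. Then there is a set of generators $\overline{f_1},\ldots,\overline{f_k}$ of the ideal $(f_1,\ldots,f_k)$ of the form $$\overline{f_i}=u^{\alpha_i}+r_i=u^{\alpha_i}+\sum_{j=1}^n\sum_{\alpha\in A_j}c_\alpha\cdot u^\alpha,$$ where $c_\alpha\in\mathcal{E}_{n+m-j}(u_{j+1},\ldots,u_n,v)$ for $\alpha\in A_j$, $j=1,\ldots,n$, and $\operatorname{supd}(r_i)\subset\Gamma\times\mathbb{N}^m$. Moreover, $\operatorname{ord}(\overline{f_i}(u,0))=\operatorname{ord}(f_i(u,0))=|\alpha_i|$, and if $\operatorname{ord}(f_i)=|\alpha_i|$ (for all $i$) then $\ope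ratorname{ord}(\overline{f_i})=|\alpha_i|$.
   Context: **Category of smooth objects over a field $K$.** For each $n\ge0$ a triple $(\mathcal{E}_n,\{x_1,\ldots,x_n\},m_n)$ such that: (1) $\mathcal{E}_0=K$, $m_0=0$. (2) $\mathcal{E}_n$ is a local ring with maximal ideal $m_n$, containing its residue field $K$. (3) $x_i\in m_n$ and their classes form a basis of $m_n/m_n^2$ over $K$. (4) There is a $K$-algebra homomorphism $T_n:\mathcal{E}_n\to\varprojlim_k\mathcal{E}_n/m_n^k\simeq K[[x_1,\ldots,x_n]]$ with kernel $m_n^\infty=\bigcap_km_n^k$ and $x_i\mapsto x_i$. (5) Any $f_1,\ldots,f_m\in m_n$ define a unique ring homomorphism $f^*:\mathcal{E}_m\to\mathcal{E}_n$ with $f^*(x_i)=f_i$, commuting with the $T$'s (written $g\mapsto g(f_1,\ldots,f_m)$); $(x_1,\ldots,x_n)$ gives the identity, and compositions of such homomorphisms are again of this form. (6) There are derivations $\partial/\partial x_i$ of $\mathcal{E}_n$ commuting with $T_n$ and inducing the standard ones on $K[[x]]$ (in positive characteristic, Hasse derivatives commuting with $T_n$). (7) For $k\le n$ the functions $(x_1,\ldots,x_k)$ define an inclusion $\mathcal{E}_k\subset\mathcal{E}_n$ compatible with the $T$'s and the derivations, with $\mathcal{E}_k=\{f\in\mathcal{E}_n:\partial f/\partial x_i=0,\ i>k\}$ (all Hasse derivatives in $x_i$, $i>k$, in positive characteristic). (8) For $k\le n$, $(x_1,\ldots,x_k,0,\ldots,0)$ defines a surjection $\mathcal{E}_n\to\mathcal{E}_k$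 with kernel $(x_{k+1},\ldots,x_n)$. (9) If $u_1,\ldots,u_n\in m_n$ and $\det[\partial u_i/\partial x_j](0)\ne0$, the map defined by $(u_1,\ldots,u_n)$ is invertible. (10) For $g(t,x)\in\mathcal{E}_{n+1}$ and $P^d=t^d+y_1t^{d-1}+\ldots+y_d\in\mathcal{E}_{n+d+1}(t,x,y)$ there are $h\in\mathcal{E}_{n+d+1}$ and $r_i\in\mathcal{E}_{n+d}(x,y)$ with $g=hP^d+\sum_{i=0}^{d-1}r_it^i$. Examples: germs of $C^\infty$ functions at $0\in\mathbb{R}^n$; germs of real or complex analytic functions; henselizations of $K[x_1,\ldots,x_n]_{(x_1,\ldots,x_n)}$; $K[[x_1,\ldots,x_n]]$. $\mathcal{E}_{n+m-j}(u_{j+1},\ldots,u_n,v)\subset\mathcal{E}_{n+m}$ is the subring of functions of the indicated coordinates. $\operatorname{ord}(f)=\sup\{k:f\in m^k\}$; $f(u,0)$ is the restriction to $v=0$; $\operatorname{supd}(f)=\{\gamma\in\mathbb{N}^{n+m}:D_\gamma f\ne0\}$ with $D_\gamma=\frac1{\gamma!}\partial^{\gamma}$ the Hasse derivatives in $(u,v)$; $|\alpha|=\sum\alpha_i$. **Diagrams.** A diagram is $\Delta=\bigcup(a_i+\mathbb{N}^n)$ for finitely many $a_i$; its vertices are its minimal generators. It is of finite type if for all $i<j$ and $\alpha\in\Delta$ there is $\alpha'_i\in\mathbb{N}$ such that replacing the $i$-th coordinate of $\alpha$ by $\alpha_i+\alpha_i'$ and the $j$-th by $0$ gives an element of $\Delta$.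 $\mathbb{N}^i$ is identified with $\mathbb{N}^i\times\{0\}\subset\mathbb{N}^n$. Reverse lexicographic order: $\alpha<_r\beta$ iff $(\alpha_n,\ldots,\alpha_1)<_{\rm lex}(\beta_n,\ldots,\beta_1)$. For vertices $\alpha_1<_r\ldots<_r\alpha_k$: $\Gamma=\mathbb{N}^n\setminus\Delta$, $\Delta_i=(\alpha_i+\mathbb{N}^n)\setminus\bigcup_{j<i}(\alpha_j+\mathbb{N}^n)$, $\Gamma_i=\Delta_i-\alpha_i$. With $\pi_{n,j}:\mathbb{N}^n\to\mathbb{N}^j$ the projection to the first $j$ coordinates, $\overline{\Gamma}^j=\mathbb{N}^j\setminus\pi_{n,j}(\Delta)$ and $A_j=\overline{\Gamma}^j\setminus(\overline{\Gamma}^{j-1}\times\mathbb{N})\subset\mathbb{N}^j$; the $A_j$ are finite and $\Gamma=\bigsqcup_jA_j\times\mathbb{N}^{n-j}$. For a vertex $\alpha_i$, if $l\ge1$ is smallest with $\alpha_i\in\mathbb{N}^l$, then $\Gamma_i=\overline{\Gamma}_i\times\mathbb{N}^{n-l+1}$ with a finite $\overline{\Gamma}_i\subset\mathbb{N}^{l-1}$; $\overline{B}_l$ is the union of the sets $\alpha_i+\overline{\Gamma}_i$ over all vertices $\alpha_i$ with this $l$. $d(\Delta)=\max\{|\alpha|:\alpha\in\bigcup_l(A_l\cup\overline{B}_l)\}$. **Generalized Jacobians.** $\Delta(s)=\{\alpha\in\Delta:|\alpha|=s\}$. For $\beta\in\Delta$ let $i(\beta)$ be the index with $\beta\in\Delta_{i(\beta)}$.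 Then $$J^s(f_1,\ldots,f_k:u^{\alpha_1},\ldots,u^{\alpha_k})=\det\big[D_{u^{\alpha-\beta+\alpha_{i(\beta)}}}(f_{i(\beta)})\big]_{\alpha,\beta\in\Delta(s)},$$ where $D_{u^\gamma}=\frac{1}{\gamma!}\partial^{|\gamma|}/\partial u^\gamma$, set to be $0$ if $\gamma$ has a negative component. Let $\operatorname{Vert}(\Delta(s))$ be the set of vertices of $\Delta$ lying in $\Delta(s)$; put $\Delta^0(s)=\Delta(s)\setminus\operatorname{Vert}(\Delta(s))$ if $\operatorname{Vert}(\Delta(s))\ne\emptyset$, and $\Delta^0(s)=\emptyset$ otherwise. $J^0_s$ is the determinant of the same matrix with $\alpha,\beta$ ranging over $\Delta^0(s)$ (an empty determinant is $1$). Invertible means invertible in $\mathcal{E}_{n+m}$, i.e. nonzero at the origin. *)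

(* Defs.v *)
(* MathComp + multinomials; no classical axioms are used. *)
From HB Require Import structures.
From mathcomp Require Import all_boot all_order all_algebra.
From mathcomp Require Import mpoly.

Set Implicit Arguments.
Unset Strict Implicit.
Unset Printing Implicit Defensive.

Import GRing.Theory.
Local Open Scope ring_scope.

(* Multi-indices: the monomials ['X_{1..n}], acting as functions ['I_n -> nat].
   All coordinates are numbered from 0. *)

Section MultiIndices.
Variables k n : nat.

(* Relabelling along [s]; for injective [s] this places [a i] at position
   [s i] and 0 outside the image of [s]. *)
Definition mnm_push (s : 'I_k -> 'I_n) (a : 'X_{1..k}) : 'X_{1..n} :=
  [multinom (\sum_(i < k | s i == j) a i)%N | j < n].

Definition mnm_pull (s : 'I_k -> 'I_n) (a : 'X_{1..n}) : 'X_{1..k} :=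
  [multinom a (s i) | i < k].

End MultiIndices.

Section PowerSeries.
Variable K : fieldType.

(* An element of K[[x_1..x_n]] is its family of coefficients. *)
Definition fps n := 'X_{1..n} -> K.

Definition fps_trunc n (d : nat) (p : fps n) : {mpoly K[n]} :=
  \sum_(a : 'X_{1..n < d.+1}) p a *: 'X_[a].

Definition fpsC n (c : K) : fps n := fun a => if a == 0%MM then c else 0.

Definition fpsX n (i : 'I_n) : fps n := fun a => (a == U_(i)%MM)%:R.

Definition fps_add n (p q : fps n) : fps n := fun a => p a + q a.

(* The coefficient of degree [a] of a product only involves the coefficients
   of total degree at most [mdeg a] of the factors. *)
Definition fps_mul n (p q : fps n) : fps n := fun a =>
  (fps_trunc (mdeg a) p * fps_trunc (mdeg a) q)@_a.

(* p(F_1, .., F_m), meaningful when the F_i have no constant term: then the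
   coefficient of degree [a] only involves coefficients of total degree at
   most [mdeg a]. *)
Definition fps_comp m n (p : fps m) (F : 'I_m -> fps n) : fps n := fun a =>
  (fps_trunc (mdeg a) p
     \mPo [tuple fps_trunc (mdeg a) (F i) | i < m])@_a.

(* D_g = (1/g!) d^g, i.e. D_g x^b = binom(b, g) x^(b - g). *)
Definition fps_hasse n (g : 'X_{1..n}) (p : fps n) : fps n := fun a =>
  (\prod_(i < n) 'C(g i + a i, g i))%N%:R * p (g + a)%MM.

End PowerSeries.

Section Ideals.
Variable R : comNzRingType.

Definition is_ideal (I : R -> Prop) : Prop :=
  [/\ I 0, forall f g, I f -> I g -> I (f + g) & forall f g, I g -> I (f * g)].

Definition ideal_gen k (f : 'I_k -> R) (g : R) : Prop :=
  exists h : 'I_k -> R, g = \sum_(i < k) h i * f i.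

Definition ideal_pow (I : R -> Prop) (k : nat) (g : R) : Prop :=
  exists (N : nat) (h : 'I_N -> R) (p : 'I_N -> 'I_k -> R),
    (forall i j, I (p i j)) /\
    g = \sum_(i < N) h i * \prod_(j < k) p i j.

End Ideals.

(* The operations of a category of smooth objects over K. *)
Record smooth_data (K : fieldType) := SmoothData {
  sring :> nat -> comUnitAlgType K;
  crd : forall n, 'I_n -> sring n;
  maxid : forall n, sring n -> Prop;
  taylor : forall n, sring n -> fps K n;
  (* [subst F] is the homomorphism g |-> g(F_1, .., F_m); it is only
     specified when all the F_i lie in the maximal ideal. *)
  subst : forall m n, ('I_m -> sring n) -> sring m -> sring n;
  (* the Hasse derivatives D_g; d/dx_i is D at the multi-index U_(i) *)
  hasse : forall n, 'X_{1..n} -> sring n -> sring n }.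

Arguments crd {K s n}.
Arguments maxid {K s n}.
Arguments taylor {K s n}.
Arguments subst {K s m n}.
Arguments hasse {K s n}.

Section Notions.
Variables (K : fieldType) (S : smooth_data K).

(* The homomorphism S_k -> S_n defined by the functions (x_(s 1), .., x_(s k)). *)
Definition incl k n (s : 'I_k -> 'I_n) : S k -> S n :=
  subst (fun i => crd (s i)).

(* The subring of S_n of the functions of the coordinates x_(s 1), .., x_(s k). *)
Definition fun_of k n (s : 'I_k -> 'I_n) (f : S n) : Prop :=
  exists g : S k, f = incl s g.

(* f |-> f(x_1, .., x_k, 0, .., 0) *)
Definition restr k l : S (k + l) -> S k :=
  subst (fun i : 'I_(k + l) =>
    match split i with inl j => crd j | inr _ => 0 end).

Definition at0 n (f : S n) : K := taylor f 0%MM.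

(* [is_ord f d] : d = sup {k : f \in m^k} and this supremum is finite. *)
Definition is_ord n (f : S n) (d : nat) : Prop :=
  (forall k, ideal_pow (@maxid K S n) k f -> (k <= d)%N) /\
  (forall b, (forall k, ideal_pow (@maxid K S n) k f -> (k <= b)%N) ->
     (d <= b)%N).

(* g(t, x) and P = t^d + y_1 t^(d-1) + .. + y_d in the coordinates (t, x, y) of
   S_(n+d+1), in this order: t has index 0, x the indices 1..n, y the indices
   n+1..n+d. *)
Definition generic_poly n d : S (n.+1 + d) :=
  crd (ord0 : 'I_(n.+1 + d)) ^+ d +
  \sum_(j < d) crd (rshift n.+1 j) * crd (ord0 : 'I_(n.+1 + d)) ^+ (d.-1 - j).

Record smooth_category : Prop := SmoothCategory {
  sring0 : forall f : S 0, exists c : K, f = c%:A;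
  maxid0 : forall f : S 0, maxid f <-> f = 0;
  maxid_ideal : forall n, is_ideal (@maxid K S n);
  maxid_local : forall n (f : S n), maxid f <-> ~~ (f \is a GRing.unit);
  residue : forall n (f : S n), exists c : K, maxid (f - c%:A);
  crd_maxid : forall n (i : 'I_n), maxid (crd i : S n);
  crd_span : forall n (f : S n), maxid f ->
    exists c : 'I_n -> K,
      ideal_pow (@maxid K S n) 2 (f - \sum_(i < n) c i *: crd i);
  crd_free : forall n (c : 'I_n -> K),
    ideal_pow (@maxid K S n) 2 (\sum_(i < n) c i *: crd i) ->
    forall i, c i = 0;
  (* [taylor_pow] says that the Taylor map identifies S_n/m^k with
     K[[x]]/(x)^k for all k, hence the inverse limit of the former with K[[x]] *)
  taylorD : forall n (f g : S n), taylor (f + g) =1 fps_add (taylor f) (taylor g);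
  taylorM : forall n (f g : S n), taylor (f * g) =1 fps_mul (taylor f) (taylor g);
  taylorC : forall n (c : K), taylor (c%:A : S n) =1 fpsC c;
  taylorX : forall n (i : 'I_n), taylor (crd i : S n) =1 fpsX K i;
  taylor_ker : forall n (f : S n),
    (taylor f =1 fun=> 0) <-> (forall k, ideal_pow (@maxid K S n) k f);
  taylor_pow : forall n (f : S n) k,
    (forall a, (mdeg a < k)%N -> taylor f a = 0) <->
    ideal_pow (@maxid K S n) k f;
  (* [subst F] is unique as a homomorphism of K-algebras; among mere ring
     homomorphisms uniqueness fails for germs of smooth functions. *)
  subst_linear : forall m n (F : 'I_m -> S n), (forall i, maxid (F i)) ->
    linear (subst F);
  subst_mul : forall m n (F : 'I_m -> S n), (forall i, maxid (F i)) ->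
    monoid_morphism (subst F);
  subst_crd : forall m n (F : 'I_m -> S n), (forall i, maxid (F i)) ->
    forall i, subst F (crd i) = F i;
  subst_taylor : forall m n (F : 'I_m -> S n), (forall i, maxid (F i)) ->
    forall g, taylor (subst F g) =1 fps_comp (taylor g) (fun i => taylor (F i));
  subst_uniq : forall m n (F : 'I_m -> S n), (forall i, maxid (F i)) ->
    forall phi : S m -> S n,
      linear phi -> monoid_morphism phi ->
      (forall i, phi (crd i) = F i) ->
      (forall g, taylor (phi g) =1
         fps_comp (taylor g) (fun i => taylor (F i))) ->
      phi =1 subst F;
  subst_id : forall n (f : S n), subst (@crd K S n) f = f;
  subst_comp : forall l m n (F : 'I_l -> S m) (G : 'I_m -> S n),
    (forall i, maxid (F i)) -> (forall i, maxid (G i)) ->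
    forall f, subst G (subst F f) = subst (fun i => subst G (F i)) f;
  (* The composition rule makes the D_g commute and, in characteristic 0,
     amounts to D_g = (1/g!) d^g. *)
  hasse_add : forall n (g : 'X_{1..n}), zmod_morphism (@hasse K S n g);
  hasse_mul : forall n (g : 'X_{1..n}) (e f : S n),
    hasse g (e * f) =
    \sum_(a : 'X_{1..n < (mdeg g).+1} | (a <= g)%MM)
       hasse a e * hasse (g - a)%MM f;
  hasse0 : forall n (f : S n), hasse 0%MM f = f;
  hasse_comp : forall n (a b : 'X_{1..n}) (f : S n),
    hasse a (hasse b f) =
    (\prod_(i < n) 'C(a i + b i, a i))%N%:R * hasse (a + b)%MM f;
  hasse_crd : forall n (i : 'I_n) (g : 'X_{1..n}), g != 0%MM ->
    hasse g (crd i : S n) = (g == U_(i)%MM)%:R;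
  hasse_taylor : forall n (g : 'X_{1..n}) (f : S n),
    taylor (hasse g f) =1 fps_hasse g (taylor f);
  (* Any k of the n coordinates are allowed: they form a set without preferred
     order. Compatibility with [taylor] is [subst_taylor]. *)
  incl_inj : forall k n (s : 'I_k -> 'I_n), injective s -> injective (incl s);
  incl_hasse : forall k n (s : 'I_k -> 'I_n), injective s ->
    forall g f, hasse (mnm_push s g) (incl s f) = incl s (hasse g f);
  incl_image : forall k n (s : 'I_k -> 'I_n), injective s ->
    forall f : S n, fun_of s f <->
      (forall (i : 'I_n) (r : nat), (forall j, s j != i) -> (0 < r)%N ->
         hasse (U_(i) *+ r)%MM f = 0);
  restr_surj : forall k l (g : S k), exists f : S (k + l), restr f = g;
  restr_ker : forall k l (f : S (k + l)),
    restr f = 0 <-> ideal_gen (fun j : 'I_l => crd (rshift k j)) f;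
  inverse_fun : forall n (u : 'I_n -> S n), (forall i, maxid (u i)) ->
    at0 (\det (\matrix_(i < n, j < n) hasse U_(j)%MM (u i))) <> 0 ->
    bijective (subst u);
  generic_division : forall n d (g : S n.+1),
    exists (h : S (n.+1 + d)) (r : 'I_d -> S (n.+1 + d)),
      (forall i, fun_of (lift ord0 : 'I_(n + d) -> 'I_(n.+1 + d)) (r i)) /\
      incl (lshift d) g =
        h * generic_poly n d +
        \sum_(i < d) r i * crd (ord0 : 'I_(n.+1 + d)) ^+ i }.

End Notions.

Section Diagrams.
Variable n : nat.
Implicit Types (D : pred 'X_{1..n}) (a b g : 'X_{1..n}) (j l : nat).

Definition is_diagram D : Prop :=
  exists s : seq 'X_{1..n}, forall b, D b = has (fun a => (a <= b)%MM) s.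

Definition is_vertex D a : Prop :=
  D a /\ forall b, D b -> (b <= a)%MM -> b = a.

Definition finite_type D : Prop :=
  forall (i j : 'I_n) a, (i < j)%N -> D a ->
  exists e : nat,
    D [multinom (if t == i then a i + e else if t == j then 0 else a t)%N
       | t < n].

Definition revlex a b : bool :=
  [exists i : 'I_n, (a i < b i)%N && [forall t : 'I_n, (i < t)%N ==> (a t == b t)]].

(* [al] lists the vertices of [D], without repetition, in increasing reverse
   lexicographic order. *)
Definition lists_vertices D k (al : 'I_k -> 'X_{1..n}) : Prop :=
  (forall a, is_vertex D a <-> exists i, al i = a) /\
  (forall i j : 'I_k, (i < j)%N -> revlex (al i) (al j)).

(* N^j, identified with N^j x {0} *)
Definition inN j a : Prop := forall t : 'I_n, (j <= t)%N -> a t = 0%N.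

(* The first [j] coordinates of [a] lie in the projection of [D] to N^j. *)
Definition in_proj D j a : Prop :=
  exists2 b, D b & forall t : 'I_n, (t < j)%N -> b t = a t.

(* A_j, for j >= 1, as a subset of N^j x {0} *)
Definition setA D j a : Prop := [/\ inN j a, ~ in_proj D j a & in_proj D j.-1 a].

Definition inDelta k (al : 'I_k -> 'X_{1..n}) (i : 'I_k) : pred 'X_{1..n} :=
  fun b => (al i <= b)%MM && [forall t : 'I_k, (t < i)%N ==> ~~ (al t <= b)%MM].

(* [l] is the smallest l >= 1 such that a lies in N^l. *)
Definition level a l : Prop :=
  [/\ (0 < l)%N, inN l a &
      forall l', (0 < l')%N -> inN l' a -> (l <= l')%N].

(* The union of the al_i + overline(Gamma)_i over the vertices al_i of level l;
   overline(Gamma)_i is the part of Gamma_i = Delta_i - al_i in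
   N^(l-1) x {0}. *)
Definition setB k (al : 'I_k -> 'X_{1..n}) l b : Prop :=
  exists (i : 'I_k) g,
    [/\ level (al i) l, inN l.-1 g, inDelta al i (al i + g)%MM
      & b = (al i + g)%MM].

(* [d] is the maximum d(D) of |a| over the union of the A_l and B_l, for
   1 <= l <= n (0 if this union is empty, that is, if n = 0 or D is empty). *)
Definition is_ddeg D k (al : 'I_k -> 'X_{1..n}) (d : nat) : Prop :=
  let U a := exists2 l, (0 < l <= n)%N & setA D l a \/ setB al l a in
  (forall a, U a -> (mdeg a <= d)%N) /\
  (forall e, (forall a, U a -> (mdeg a <= e)%N) -> (d <= e)%N).

Definition Dset D s : {set 'X_{1..n < s.+1}} :=
  [set b : 'X_{1..n < s.+1} | D b && (mdeg b == s)].

Definition Vert D k (al : 'I_k -> 'X_{1..n}) s : {set 'X_{1..n < s.+1}} :=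
  [set b in Dset D s | [exists i, al i == b]].

Definition Dset0 D k (al : 'I_k -> 'X_{1..n}) s : {set 'X_{1..n < s.+1}} :=
  if Vert D al s != set0 then Dset D s :\: Vert D al s else set0.

End Diagrams.

(* Functions on S_(n+m), whose coordinates are u_i = x_(lshift m i), i < n, and
   v_i = x_(rshift n i), i < m. *)
Section Jacobians.
Variables (K : fieldType) (S : smooth_data K) (n m : nat).

Definition umon (a : 'X_{1..n}) : S (n + m) :=
  \prod_(i < n) crd (lshift m i) ^+ a i.

Definition hasse_u (g : 'X_{1..n}) (f : S (n + m)) : S (n + m) :=
  hasse (mnm_push (lshift m) g) f.

(* The entry D_{u^(a - b + al_i(b))} f_i(b), zero if the exponent has a negative
   component; i(b) is the unique i with b in Delta_i, so that the default value
   is never used for b in D. *)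
Definition jac_entry k (al : 'I_k -> 'X_{1..n}) (f : 'I_k -> S (n + m))
    (a b : 'X_{1..n}) : S (n + m) :=
  if [pick i | inDelta al i b] is Some i then
    if (b <= a + al i)%MM then hasse_u (a + al i - b)%MM (f i) else 0
  else 0.

(* The determinant is independent of the enumeration of [A]. *)
Definition jac k (al : 'I_k -> 'X_{1..n}) (f : 'I_k -> S (n + m))
    s (A : {set 'X_{1..n < s.+1}}) : S (n + m) :=
  \det (\matrix_(p < #|A|, q < #|A|) jac_entry al f (enum_val p) (enum_val q)).

Definition genJ (D : pred 'X_{1..n}) k (al : 'I_k -> 'X_{1..n}) f s :=
  jac al f (Dset D s).

Definition genJ0 (D : pred 'X_{1..n}) k (al : 'I_k -> 'X_{1..n}) f s :=
  jac al f (Dset0 D al s).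

Definition supd N (f : S N) (g : 'X_{1..N}) : Prop := hasse g f <> 0.

Lemma tail_ord_subproof N j (i : 'I_(N - j)) : (i + j < N)%N.
Proof. by rewrite addnC -ltn_subRL. Qed.

Definition tail_ord N j (i : 'I_(N - j)) : 'I_N := Ordinal (tail_ord_subproof i).

(* r = sum_{j = 1..n} sum_{a in A_j} c_a u^a, with c_a a function of
   (u_(j+1), .., u_n, v) for a in A_j. The ordinal j < n stands for j + 1. *)
Definition normal_form (D : pred 'X_{1..n}) (r : S (n + m)) : Prop :=
  exists (A : 'I_n -> seq 'X_{1..n}) (c : 'X_{1..n} -> S (n + m)),
    [/\ forall j, uniq (A j) /\ (forall a, a \in A j <-> setA D j.+1 a),
        forall (j : 'I_n) a, a \in A j -> fun_of (@tail_ord (n + m) j.+1) (c a)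
      & r = \sum_(j < n) \sum_(a <- A j) c a * umon a].

End Jacobians.

(* Main.v *)
Require Import Defs.
From HB Require Import structures.
From mathcomp Require Import all_boot all_order all_algebra.
From mathcomp Require Import perm mpoly zify ring.

(** Write R for the ring of functions of (u, v), and E_j for its subring of the
    functions that do not involve the first j coordinates.

    The heart of the matter is a division theorem: every x in R is
    sum_i q_i f_i + r with q_i supported in Gamma_i and r supported in Gamma
    ([division]). Since Gamma_i and Gamma are finite unions of translates of
    orthants N^(n-j), this says that finitely many elements e of R (the products
    u^g f_i with g in the finite part of Gamma_i, and the monomials u^a with a in
    A_j), each of them with a level lev(e), satisfy R = sum_e E_lev(e) e. The
    ring of coefficients varies with e, so R is not merely finitely generated
    over a ring, and the proof has to go down the tower E_0, E_1, .., E_n.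

    At each floor, the quotient of R by the terms already used is finitely
    generated over E_j. Let t be the coordinate of E_j that E_(j+1) lacks. By a
    form of the Malgrange preparation theorem ([malgrange]), the quotient is also
    finitely generated over E_(j+1) as soon as some r of its elements span it over
    K modulo t^(r+1) and the maximal ideal of E_(j+1). Indeed t then satisfies a
    characteristic equation P(t) = 0 with P regular in t, and one divides by P
    ([weierstrass], which comes from the generic division and from the inverse
    function theorem). The result ([tower]) is that it suffices to have
    R = sum_e E_lev(e) e modulo v and every power of the maximal ideal.

    This last condition is linear algebra in each degree s, at v = 0: the matrix
    of J^s expresses the degree s parts of the u^(b - al_i(b)) f_i(b) in terms of
    the monomials in Delta, so the invertibility of J^s says that these products
    and the monomials in Gamma span. Only s <= d + 1 is assumed, but the span in
    higher degrees follows, because all the generators have degree at most d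
    ([gspan_step]).

    Dividing -u^(al_i) gives fb_i = u^(al_i) + r_i = sum_j q_ij f_j. Conversely,
    comparing the terms of lowest degree, the same Jacobians show that such a
    division is essentially unique ([division_unique]): q_ij has order at least
    |al_i| - |al_j|. Hence the matrix (q_ij(0)) is block triangular with respect
    to the degrees of the vertices. Up to transposition, its diagonal block
    in degree s is the part of the inverse of the matrix of J^s indexed by the
    vertices, which is nonsingular exactly when the complementary minor J^0_s is
    nonzero
    ([quotient_unit]). So (q_ij) is invertible and the fb_i generate the same
    ideal. The bounds on the orders of the q_ij also give the orders of the fb_i;
    a weight on v treats the order in (u, v) and the order at v = 0 together. *)

Set Implicit Arguments.
Unset Strict Implicit.
Unset Printing Implicit Defensive.

Import GRing.Theory.
Local Open Scope ring_scope.

(** * Multi-indices *)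
Section Multi.
Variable n : nat.
Implicit Types (a b c : 'X_{1..n}) (i j : 'I_n).

Lemma mdeg_sub a b : (b <= a)%MM -> mdeg (a - b) = (mdeg a - mdeg b)%N.
Proof. by move=> h; rewrite -{2}(submK h) mdegD addnK. Qed.

Lemma mdeg_le a b : (b <= a)%MM -> (mdeg b <= mdeg a)%N.
Proof. by move=> h; rewrite -(submK h) mdegD leq_addl. Qed.

Lemma mnm_neq0 a : a != 0%MM -> exists i, (0 < a i)%N.
Proof.
move=> h; case: (pickP (fun i : 'I_n => (0 < a i)%N)) => [i hi|h0]; first by exists i.
by case/eqP: h; apply/mnmP=> i; rewrite mnm0E; move: (h0 i); rewrite lt0n => /negbFE/eqP.
Qed.

Lemma submKC a b : (b <= a)%MM -> (b + (a - b))%MM = a.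
Proof. by move=> h; rewrite addmC submK. Qed.

Lemma mnm_ind (P : 'X_{1..n} -> Prop) :
  P 0%MM -> (forall i a, P a -> P (U_(i) + a)%MM) -> forall a, P a.
Proof.
move=> h0 hS a; have [d] := ubnP (mdeg a); elim: d a => // d IH a hd.
have [->//|/mnm_neq0[i hi]] := eqVneq a 0%MM.
have hU : (U_(i) <= a)%MM by rewrite lep1mP -lt0n.
rewrite -(submKC hU); apply: hS; apply: IH.
rewrite mdeg_sub // mdeg1 subn1 prednK ?lt0n ?mdeg_eq0; last first.
  by apply: contraTneq hi => ->; rewrite mnm0E.
by rewrite -ltnS in hd *.
Qed.

End Multi.

Section Push.
Variables (k n : nat) (s : 'I_k -> 'I_n).
Hypothesis inj_s : injective s.

Lemma mnm_push_in (a : 'X_{1..k}) i : mnm_push s a (s i) = a i.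
Proof.
rewrite mnmE (bigD1 i) //= big1 ?addn0 // => j /andP[/eqP/inj_s -> ].
by rewrite eqxx.
Qed.

Lemma mnm_push_out (a : 'X_{1..k}) j : (forall i, s i != j) -> mnm_push s a j = 0%N.
Proof. by move=> h; rewrite mnmE big1 // => i; rewrite (negPf (h i)). Qed.

Lemma mnm_pushK : cancel (mnm_push s) (mnm_pull s).
Proof. by move=> a; apply/mnmP=> i; rewrite mnmE mnm_push_in. Qed.

Lemma mnm_pullK (a : 'X_{1..n}) : (forall j, (forall i, s i != j) -> a j = 0%N) ->
  mnm_push s (mnm_pull s a) = a.
Proof.
move=> h; apply/mnmP=> j; case: (pickP (fun i => s i == j)) => [i /eqP<-|hj].
  by rewrite mnm_push_in mnmE.
have hj' i : s i != j by rewrite hj.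
by rewrite mnm_push_out // h.
Qed.

End Push.

Lemma mnm_pushD k n (s : 'I_k -> 'I_n) (a b : 'X_{1..k}) :
  mnm_push s (a + b) = (mnm_push s a + mnm_push s b)%MM.
Proof.
apply/mnmP=> j; rewrite mnmDE !mnmE -big_split; apply: eq_bigr => i _.
by rewrite mnmDE.
Qed.

Lemma mnm_push0 k n (s : 'I_k -> 'I_n) : mnm_push s 0%MM = 0%MM.
Proof. by apply/mnmP=> j; rewrite mnm0E mnmE big1 // => i _; rewrite mnm0E. Qed.

Lemma mnm_push1 k n (s : 'I_k -> 'I_n) i : mnm_push s U_(i)%MM = U_(s i)%MM.
Proof.
apply/mnmP=> j; rewrite mnmE mnm1E big_mkcond (bigD1 i) //= big1 => [|t ht].
  by rewrite mnm1E eqxx addn0; case: eqP.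
by case: ifP => // _; rewrite mnm1E eq_sym (negPf ht).
Qed.

Lemma mnm_pushMn k n (s : 'I_k -> 'I_n) (a : 'X_{1..k}) e :
  mnm_push s (a *+ e)%MM = (mnm_push s a *+ e)%MM.
Proof.
elim: e => [|e IH]; first by rewrite !mulm0n mnm_push0.
by rewrite !mulmS mnm_pushD IH.
Qed.

Lemma mdeg_push k n (s : 'I_k -> 'I_n) (a : 'X_{1..k}) : mdeg (mnm_push s a) = mdeg a.
Proof.
elim/mnm_ind: a => [|i a IH]; first by rewrite mnm_push0 !mdeg0.
by rewrite mnm_pushD !mdegD IH mnm_push1 !mdeg1.
Qed.

(** * Ideals, values at the origin and Taylor coefficients *)
Section IdealBasics.
Variable R : comNzRingType.

Lemma ideal_sum (I : R -> Prop) : is_ideal I -> forall (T : Type) (r : seq T) (P : pred T) F,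
  (forall i, P i -> I (F i)) -> I (\sum_(i <- r | P i) F i).
Proof. by case=> h0 hD _ T r P F h; elim/big_ind: _. Qed.

Lemma ideal_opp (I : R -> Prop) : is_ideal I -> forall x, I x -> I (- x).
Proof. by case=> _ _ hM x hx; rewrite -mulN1r; apply: hM. Qed.

Lemma ideal_mulr (I : R -> Prop) : is_ideal I -> forall x y, I x -> I (x * y).
Proof. by case=> _ _ hM x y hx; rewrite mulrC; apply: hM. Qed.

Lemma ideal_pow1 (I : R -> Prop) : is_ideal I -> forall g, ideal_pow I 1 g <-> I g.
Proof.
move=> hI g; split=> [[N [h [p [hp ->]]]]|hg].
  by apply: ideal_sum => // i _; case: hI => _ _; apply; rewrite big_ord1.
exists 1%N, (fun=> 1), (fun _ _ => g); split=> //.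
by rewrite !big_ord1 mul1r.
Qed.

End IdealBasics.

Section Basics.
Variables (K : fieldType) (S : smooth_data K).
Hypothesis hS : smooth_category S.

Lemma maxid_at0 n (f : S n) : maxid f <-> at0 f = 0.
Proof.
have h := taylor_pow hS f 1; rewrite (ideal_pow1 (maxid_ideal hS n)) in h.
split=> [/h hh|h0]; first by apply: hh; rewrite mdeg0.
by apply/h => a; rewrite ltnS leqn0 mdeg_eq0 => /eqP ->.
Qed.

Lemma at0D n (f g : S n) : at0 (f + g) = at0 f + at0 g.
Proof. exact: (taylorD hS). Qed.

Lemma at0C n c : at0 (c%:A : S n) = c.
Proof. by rewrite /at0 (taylorC hS) /fpsC eqxx. Qed.

Lemma at0_0 n : at0 (0 : S n) = 0.
Proof. by apply/maxid_at0; case: (maxid_ideal hS n). Qed.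

Lemma at0N n (f : S n) : at0 (- f) = - at0 f.
Proof. by apply/eqP; rewrite -addr_eq0 addrC -at0D subrr at0_0. Qed.

Lemma at0B n (f g : S n) : at0 (f - g) = at0 f - at0 g.
Proof. by rewrite at0D at0N. Qed.

Lemma at0_res n (f : S n) : maxid (f - (at0 f)%:A).
Proof. by apply/maxid_at0; rewrite at0B at0C subrr. Qed.

Lemma at0M n (f g : S n) : at0 (f * g) = at0 f * at0 g.
Proof.
apply/eqP; rewrite -subr_eq0 -(at0C n (_ * _)) -at0B; apply/eqP/maxid_at0.
have -> : f * g - (at0 f * at0 g)%:A =
    f * (g - (at0 g)%:A) + (f - (at0 f)%:A) * (at0 g)%:A.
  by rewrite mulrBr mulrBl addrA subrK -scalerAl mul1r scalerA.
have hI := maxid_ideal hS n; case: (hI) => _ hD hM.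
by apply: hD; [apply: hM|apply: ideal_mulr => //]; apply: at0_res.
Qed.

Lemma at01 n : at0 (1 : S n) = 1.
Proof. by rewrite -(scale1r 1) at0C. Qed.

Lemma at0_sum n (T : Type) (r : seq T) (P : pred T) (F : T -> S n) :
  at0 (\sum_(i <- r | P i) F i) = \sum_(i <- r | P i) at0 (F i).
Proof. by elim/big_rec2: _ => [|i x y _ <-]; [apply: at0_0|apply: at0D]. Qed.

Lemma unit_at0 n (f : S n) : (f \is a GRing.unit) = (at0 f != 0).
Proof.
apply/idP/idP => [hf|hf].
  apply/eqP=> h0; move/maxid_at0/(maxid_local hS): h0; by rewrite hf.
by apply/negPn/negP => /(maxid_local hS)/maxid_at0 h0; rewrite h0 eqxx in hf.
Qed.

Lemma crd_at0 n (i : 'I_n) : at0 (crd i : S n) = 0.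
Proof. by apply/maxid_at0; apply: (crd_maxid hS). Qed.

(** Through this identity the Leibniz rule for Hasse derivatives gives the
    product formula for Taylor coefficients. *)
Lemma taylorE n (f : S n) a : taylor f a = at0 (hasse a f).
Proof.
rewrite /at0 (hasse_taylor hS) /fps_hasse addm0 big1 ?mul1r // => i _.
by rewrite mnm0E addn0 binn.
Qed.

Lemma taylor_add n (f g : S n) a : taylor (f + g) a = taylor f a + taylor g a.
Proof. exact: (taylorD hS). Qed.

Lemma taylor0 n a : taylor (0 : S n) a = 0.
Proof.
by have := taylor_add (0 : S n) 0 a; rewrite addr0 => /esym/eqP; rewrite -subr_eq0 addrK => /eqP.
Qed.

Lemma taylorN n (f : S n) a : taylor (- f) a = - taylor f a.
Proof. by apply/eqP; rewrite -addr_eq0 addrC -taylor_add subrr taylor0. Qed.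

Lemma taylorB n (f g : S n) a : taylor (f - g) a = taylor f a - taylor g a.
Proof. by rewrite taylor_add taylorN. Qed.

Lemma taylor_sum n (T : Type) (r : seq T) (P : pred T) (F : T -> S n) a :
  taylor (\sum_(i <- r | P i) F i) a = \sum_(i <- r | P i) taylor (F i) a.
Proof. by elim/big_rec2: _ => [|i x y _ <-]; [apply: taylor0|apply: taylor_add]. Qed.

Lemma taylor_mul n (f g : S n) a : taylor (f * g) a =
  \sum_(b : 'X_{1..n < (mdeg a).+1} | (b <= a)%MM) taylor f b * taylor g (a - b)%MM.
Proof.
rewrite taylorE (hasse_mul hS) at0_sum; apply: eq_bigr => b hb.
by rewrite at0M -!taylorE.
Qed.

Lemma taylorZ n c (f : S n) a : taylor (c *: f) a = c * taylor f a.
Proof.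
rewrite -mulr_algl taylor_mul (bigD1 bm0) /=; last by apply/mnm_lepP=> i; rewrite mnm0E.
rewrite (taylorC hS) /fpsC eqxx subm0 big1 ?addr0 // => b /andP[_ hb].
by rewrite (taylorC hS) /fpsC -(bmeqP b bm0) (negPf hb) mul0r.
Qed.

Lemma taylor_crdM n i (f : S n) a :
  taylor (crd i * f) a = if (0 < a i)%N then taylor f (a - U_(i))%MM else 0.
Proof.
rewrite taylor_mul; case: ifP => hi; last first.
  rewrite big1 // => b /mnm_lepP/(_ i); rewrite (taylorX hS) /fpsX.
  case: eqP => [->|]; last by rewrite mul0r.
  by rewrite mnm1E eqxx hi.
have hU : (U_(i) <= a)%MM by rewrite lep1mP -lt0n.
have hd : (mdeg U_(i)%MM < (mdeg a).+1)%N by rewrite ltnS mdeg_le.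
rewrite (bigD1 (BMultinom hd)) //= (taylorX hS) /fpsX eqxx mul1r big1 ?addr0 //.
move=> b /andP[_ hb]; rewrite (taylorX hS) /fpsX.
by rewrite -(bmeqP b (BMultinom hd)) (negPf hb) mul0r.
Qed.

Lemma taylor_crdXM n i (f : S n) e a :
  taylor (crd i ^+ e * f) a = if (e <= a i)%N then taylor f (a - U_(i) *+ e)%MM else 0.
Proof.
elim: e a => [|e IH] a; first by rewrite mul1r mulm0n subm0.
rewrite exprS -mulrA taylor_crdM; case: ltnP => [h0|]; last first.
  by rewrite leqn0 => /eqP ->.
rewrite IH mnmBE mnm1E eqxx submDA -mulmS subn1 -ltnS prednK //.
Qed.

Definition mon n (a : 'X_{1..n}) : S n := \prod_(i < n) crd i ^+ a i.

Lemma mon0 n : mon (0%MM : 'X_{1..n}) = 1.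
Proof. by rewrite /mon big1 // => i _; rewrite mnm0E. Qed.

Lemma monD n (a b : 'X_{1..n}) : mon (a + b)%MM = mon a * mon b.
Proof. by rewrite /mon -big_split; apply: eq_bigr => i _; rewrite mnmDE exprD. Qed.

Lemma mon1 n (i : 'I_n) : mon U_(i)%MM = crd i.
Proof.
rewrite /mon (bigD1 i) //= mnm1E eqxx expr1 big1 ?mulr1 // => j hj.
by rewrite mnm1E eq_sym (negPf hj).
Qed.

Lemma taylor_monM n (a : 'X_{1..n}) (f : S n) b :
  taylor (mon a * f) b = if (a <= b)%MM then taylor f (b - a)%MM else 0.
Proof.
elim/mnm_ind: a f b => [|i a IH] f b.
  by rewrite mon0 mul1r subm0; case: ifP => // /mnm_lepP[] j; rewrite mnm0E.
rewrite monD mon1 -mulrA taylor_crdM.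
case: ltnP => [hi|]; last first.
  rewrite leqn0 => /eqP h0; case: ifP => // /mnm_lepP/(_ i).
  by rewrite mnmDE mnm1E eqxx h0.
rewrite IH submDA; congr (if _ then _ else _).
by apply/mnm_lepP/mnm_lepP => h j; move: (h j) hi; rewrite !(mnmDE, mnmBE, mnm1E);
  case: eqP => [<-|_] /=; lia.
Qed.

Lemma taylor_mon n (a b : 'X_{1..n}) : taylor (mon a) b = (a == b)%:R.
Proof.
rewrite -(mulr1 (mon a)) taylor_monM -(scale1r 1) (taylorC hS) /fpsC.
have [->|hab] := eqVneq a b; first by rewrite lepm_refl -{1}(addm0 b) addmC addmK eqxx.
case: ifP => // hle; case: eqP => // h0; case/eqP: hab.
by rewrite -(submK hle) h0 add0m.
Qed.

Lemma hasse_0 n c : hasse c (0 : S n) = 0.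
Proof. by have := hasse_add hS c (0 : S n) 0; rewrite !subrr. Qed.

Lemma hasseD n c (f g : S n) : hasse c (f + g) = hasse c f + hasse c g.
Proof.
have hN x : hasse c (- x : S n) = - hasse c x.
  by have := hasse_add hS c 0 x; rewrite !sub0r hasse_0 sub0r.
by have := hasse_add hS c f (- g); rewrite opprK hN opprK.
Qed.

Lemma hasse_sum n (T : Type) (r : seq T) (P : pred T) (F : T -> S n) a :
  hasse a (\sum_(i <- r | P i) F i) = \sum_(i <- r | P i) hasse a (F i).
Proof. by elim/big_rec2: _ => [|i x y _ <-]; [apply: hasse_0|apply: hasseD]. Qed.

End Basics.

(** * Substitutions as ring morphisms *)

(** The operations of a category are morphisms only by virtue of its axioms.
    Versions that take the axioms as an argument can carry the canonical
    morphism structures. *)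
Definition at0r K (S : smooth_data K) (hS : smooth_category S) n : S n -> K := @at0 K S n.
HB.instance Definition _ K (S : smooth_data K) (hS : smooth_category S) n :=
  GRing.isZmodMorphism.Build (S n) K (@at0r K S hS n) (@at0B K S hS n).
HB.instance Definition _ K (S : smooth_data K) (hS : smooth_category S) n :=
  GRing.isMonoidMorphism.Build (S n) K (@at0r K S hS n)
    (at01 hS n, @at0M K S hS n).

Section Subst.
Variables (K : fieldType) (S : smooth_data K).
Hypothesis hS : smooth_category S.
Variables (m n : nat) (F : 'I_m -> S n).
Hypothesis hF : forall i, maxid (F i).

Lemma substB f g : subst F (f - g) = subst F f - subst F g.
Proof. 
by rewrite addrC -scaleN1r (subst_linear hS hF) scaleN1r addrC.
Qed.

Lemma substM f g : subst F (f * g) = subst F f * subst F g.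
Proof. by case: (subst_mul hS hF). Qed.

Lemma subst1 : subst F 1 = 1.
Proof. by case: (subst_mul hS hF). Qed.

Lemma subst0 : subst F 0 = 0.
Proof. by rewrite -(subrr 0) substB subrr. Qed.

Lemma substC c : subst F c%:A = c%:A.
Proof. 
by have := subst_linear hS hF c 1 0; rewrite subst0 !addr0 subst1.
Qed.

Lemma substD f g : subst F (f + g) = subst F f + subst F g.
Proof. by rewrite -{1}[f]scale1r (subst_linear hS hF) scale1r. Qed.

Lemma at0_subst f : at0 (subst F f) = at0 f.
Proof.
rewrite /at0 (subst_taylor hS hF) /fps_comp /fps_trunc mdeg0.
rewrite (bigD1 bm0) //= big1 ?addr0; last first.
  move=> b hb; case/negP: hb; apply/eqP/val_inj/eqP => /=.
  by rewrite -mdeg_eq0 -leqn0 -ltnS bmdeg.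
by rewrite mpolyX0 comp_mpolyZ comp_mpoly1 mcoeffZ mcoeff1 eqxx mulr1.
Qed.

Lemma maxid_subst f : maxid f -> maxid (subst F f).
Proof. by move/(maxid_at0 hS) => h; apply/(maxid_at0 hS); rewrite at0_subst. Qed.

(** The uniqueness axiom makes substitution extensional. *)
Lemma subst_ext (G : 'I_m -> S n) : F =1 G -> subst F =1 subst G.
Proof.
move=> FG; have hG i : maxid (G i) by rewrite -FG.
apply: (subst_uniq hS hG); [exact: (subst_linear hS)|exact: (subst_mul hS)| |].
  by move=> i; rewrite (subst_crd hS) // FG.
move=> g a; rewrite (subst_taylor hS hF) /fps_comp; congr ((_ \mPo _)@__).
by apply: eq_from_tnth => i; rewrite !tnth_mktuple FG.
Qed.

End Subst.

Definition inclr K (S : smooth_data K) (hS : smooth_category S) k n (s : 'I_k -> 'I_n) :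
  S k -> S n := incl s.

Lemma maxid_crd K (S : smooth_data K) (hS : smooth_category S) k n (s : 'I_k -> 'I_n) i :
  maxid (crd (s i) : S n).
Proof. exact: (crd_maxid hS). Qed.

HB.instance Definition _ K (S : smooth_data K) (hS : smooth_category S) k n (s : 'I_k -> 'I_n) :=
  GRing.isZmodMorphism.Build (S k) (S n) (inclr hS s) (substB hS (maxid_crd hS s)).
HB.instance Definition _ K (S : smooth_data K) (hS : smooth_category S) k n (s : 'I_k -> 'I_n) :=
  GRing.isMonoidMorphism.Build (S k) (S n) (inclr hS s)
    (subst1 hS (maxid_crd hS s), substM hS (maxid_crd hS s)).

Definition restrr K (S : smooth_data K) (hS : smooth_category S) k l :
  S (k + l)%N -> S k := @restr K S k l.

Lemma maxid_restr_arg K (S : smooth_data K) (hS : smooth_category S) k l (i : 'I_(k + l)) :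
  maxid (match split i with inl j => crd j | inr _ => 0 end : S k).
Proof.
by case: split => ?; [apply: (crd_maxid hS)|case: (maxid_ideal hS k)].
Qed.

HB.instance Definition _ K (S : smooth_data K) (hS : smooth_category S) k l :=
  GRing.isZmodMorphism.Build (S (k + l)%N) (S k) (@restrr K S hS k l)
     (substB hS (@maxid_restr_arg K S hS k l)).
HB.instance Definition _ K (S : smooth_data K) (hS : smooth_category S) k l :=
  GRing.isMonoidMorphism.Build (S (k + l)%N) (S k) (@restrr K S hS k l)
    (subst1 hS (@maxid_restr_arg K S hS k l), substM hS (@maxid_restr_arg K S hS k l)).

Section Incl.
Variables (K : fieldType) (S : smooth_data K).
Hypothesis hS : smooth_category S.

Lemma inclE k n (s : 'I_k -> 'I_n) (f : S k) : incl s f = inclr hS s f.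
Proof. by []. Qed.

Lemma incl_crd k n (s : 'I_k -> 'I_n) i : incl s (crd i : S k) = crd (s i).
Proof. by rewrite /incl (subst_crd hS) //; apply: maxid_crd. Qed.

Lemma incl_comp k l n (s : 'I_k -> 'I_l) (t : 'I_l -> 'I_n) (f : S k) :
  incl t (incl s f) = incl (t \o s) f.
Proof.
rewrite /incl (subst_comp hS); try exact: maxid_crd.
apply: (subst_ext hS) => i; last by rewrite (subst_crd hS) //; apply: maxid_crd.
by apply: (maxid_subst hS); apply: maxid_crd.
Qed.

Lemma incl_ext k n (s t : 'I_k -> 'I_n) : s =1 t -> @incl K S k n s =1 incl t.
Proof.
by move=> h; apply: (subst_ext hS) => i; [apply: maxid_crd|rewrite h].
Qed.

Lemma restr_crdl k l (i : 'I_k) : restr (crd (lshift l i) : S (k + l)%N) = crd i.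
Proof.
rewrite /restr (subst_crd hS); last exact: maxid_restr_arg.
by rewrite (unsplitK (inl i)).
Qed.

Lemma restr_crdr k l (i : 'I_l) : restr (crd (rshift k i) : S (k + l)%N) = 0.
Proof.
rewrite /restr (subst_crd hS); last exact: maxid_restr_arg.
by rewrite (unsplitK (inr i)).
Qed.

Lemma restr_incl k l (f : S k) : restr (incl (lshift l) f) = f.
Proof.
rewrite /restr /incl (subst_comp hS); [|exact: maxid_crd|exact: maxid_restr_arg].
rewrite -[RHS](subst_id hS); apply: (subst_ext hS) => i.
  by apply: (maxid_subst hS); [exact: maxid_restr_arg|exact: maxid_crd].
exact: restr_crdl.
Qed.

(** Hadamard's lemma: f - f(x, 0) restricts to 0, so it lies in the ideal of the
    remaining coordinates. *)
Lemma restr_decomp k l (f : S (k + l)%N) :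
  exists y : 'I_l -> S (k + l)%N,
    f = incl (lshift l) (restr f) + \sum_(j < l) crd (rshift k j) * y j.
Proof.
have /(restr_ker hS)[y hy] : restr (f - incl (lshift l) (restr f)) = 0.
  by rewrite -[LHS]/(restrr hS _) rmorphB /= /restrr restr_incl subrr.
exists y; rewrite -[LHS](subrK (incl (lshift l) (restr f))) addrC hy.
by congr (_ + _); apply: eq_bigr => j _; rewrite mulrC.
Qed.

(** The case of [restr_decomp] in which all the coordinates are set to 0. *)
Lemma maxid_decomp p (f : S p) : exists y : 'I_p -> S p,
  f = (at0 f)%:A + \sum_(i < p) crd i * y i.
Proof.
have [y hy] := @restr_decomp 0 p f.
have [c hc] := sring0 hS (@restr K S 0 p f).
have e0 : incl (lshift p) (@restr K S 0 p f) = c%:A.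
  by rewrite hc /incl (substC hS) //; apply: maxid_crd.
have hat : at0 f = c.
  rewrite [f]hy (at0D hS) e0 (at0C hS) (at0_sum hS) big1 ?addr0 // => j _.
  by rewrite (at0M hS) (crd_at0 hS) mul0r.
exists y; rewrite {1}hy e0 hat; congr (_ + _); apply: eq_bigr => j _.
by congr (crd _ * _); apply: val_inj.
Qed.

Lemma taylor_incl k n (s : 'I_k -> 'I_n) (f : S k) a : injective s ->
  taylor (incl s f) (mnm_push s a) = taylor f a.
Proof.
move=> hs; rewrite !(taylorE hS) (incl_hasse hS) // /incl at0_subst //.
exact: maxid_crd.
Qed.

(** The axiom on the image of an inclusion only concerns derivatives in one
    variable; the general case splits off the [i]-th component of [c], the
    binomial factor being 1. *)
Lemma hasse_out k n (s : 'I_k -> 'I_n) (f : S n) (c : 'X_{1..n}) i :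
  injective s -> fun_of s f -> (forall j, s j != i) -> (0 < c i)%N -> hasse c f = 0.
Proof.
move=> hs /(incl_image hS hs) hf hi ci.
have hle : (U_(i) *+ c i <= c)%MM.
  by apply/mnm_lepP=> j; rewrite mulmnE mnm1E; case: eqP => [->|]; rewrite ?mul1n.
have := hasse_comp hS (c - U_(i) *+ c i)%MM (U_(i) *+ c i)%MM f.
rewrite (hf i _ hi ci) hasse_0 // submK // big1 ?mul1r // => j _.
rewrite mnmBE mulmnE mnm1E; case: eqP => [->|_]; first by rewrite mul1n subnn bin0.
by rewrite mul0n subn0 addn0 binn.
Qed.

Lemma taylor_out k n (s : 'I_k -> 'I_n) (f : S n) (c : 'X_{1..n}) i :
  injective s -> fun_of s f -> (forall j, s j != i) -> (0 < c i)%N -> taylor f c = 0.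
Proof. by move=> hs hf hi ci; rewrite taylorE // (hasse_out hs hf hi ci) at0_0. Qed.

(** The constants are the functions of no coordinate at all. *)
Lemma hasse1 n (c : 'X_{1..n}) : c != 0%MM -> hasse c (1 : S n) = 0.
Proof.
case/mnm_neq0 => i hi; have s : 'I_0 -> 'I_n by case.
apply: (@hasse_out 0 n s _ _ i) => //; try by case.
by exists 1; rewrite inclE rmorph1.
Qed.

(** This holds in the ring itself, which [taylor_mon] would not give: the Taylor
    map need not be injective. *)
Lemma hasse_mon0 n (a b : 'X_{1..n}) : ~~ (b <= a)%MM -> hasse b (mon S a) = 0.
Proof.
elim/mnm_ind: a b => [|i a IH] b hb.
  by rewrite mon0 hasse1 //; apply: contra hb => /eqP ->; apply: lepm_refl.
rewrite monD mon1 (hasse_mul hS) big1 // => c hc.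
have [hc0|hc0] := eqVneq (val c) 0%MM.
  rewrite hc0 subm0 IH ?mulr0 //; apply: contra hb => h.
  by apply: lepm_trans h _; apply: lem_addl.
rewrite (hasse_crd hS) //; case: eqP => [e|]; last by rewrite mul0r.
rewrite e IH ?mulr0 //; apply: contra hb => /mnm_lepP h; apply/mnm_lepP=> j.
by move: (h j); rewrite mnmBE mnmDE leq_subLR.
Qed.

End Incl.

(** * Weierstrass division *)
Section Weierstrass.
Variables (K : fieldType) (S : smooth_data K).
Hypothesis hS : smooth_category S.

(** The implicit function theorem, for the equations rho(x, y) = 0: the map
    (x, rho) has an inverse of the form (x, W), and Y(x) = W(x, 0). *)
Lemma implicit_fun n d (rho : 'I_d -> S (n + d)%N) :
  (forall j, maxid (rho j)) ->
  \det (\matrix_(i < d, j < d) taylor (rho i) U_(rshift n j)%MM) != 0 ->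
  exists Y : 'I_d -> S n, (forall j, maxid (Y j)) /\
    forall j, subst (fun a : 'I_(n + d) =>
      match split a with inl i => crd i | inr j => Y j end) (rho j) = 0.
Proof.
move=> hrho hdet.
pose u (a : 'I_(n + d)) : S (n + d)%N :=
  match split a with inl i => crd (lshift d i) | inr j => rho j end.
have ul i : u (lshift d i) = crd (lshift d i) by rewrite /u (unsplitK (inl i)).
have ur j : u (rshift n j) = rho j by rewrite /u (unsplitK (inr j)).
have hu a : maxid (u a).
  by case: (splitP a) => [i|j] ha; rewrite /u; case: split => ? //; apply: (crd_maxid hS).
have hbij : bijective (subst u).
  apply: (inverse_fun hS hu).
  (* the Jacobian matrix of (x, rho) is block triangular *)
  have -> : forall M : 'M[S (n + d)%N]_(n + d), at0 (\det M) = \det (map_mx (at0r hS (n:=_)) M).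
    by move=> M; rewrite det_map_mx.
  set M := map_mx _ _.
  have -> : M = block_mx 1%:M 0 (dlsubmx M)
      (\matrix_(i < d, j < d) taylor (rho i) U_(rshift n j)%MM).
    rewrite -[LHS]submxK; congr block_mx; apply/matrixP => i j; rewrite !mxE.
    - rewrite /at0r -(taylorE hS) ul (taylorX hS) /fpsX eq_mnm1.
      by rewrite eq_sym (inj_eq (@lshift_inj _ _)).
    - by rewrite /at0r -(taylorE hS) ul (taylorX hS) /fpsX eq_mnm1 eq_rlshift.
    - by rewrite /at0r -(taylorE hS) ur.
  by apply/eqP; rewrite det_lblock det1 mul1r.
case: hbij => w uw wu.
have inju : injective (subst u) by apply: can_inj uw.
pose W a := w (crd a).
have hW a : maxid (W a).
  apply/(maxid_at0 hS); rewrite -(at0_subst hS hu) /W wu; exact: crd_at0.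
have Wu a : subst W (u a) = crd a.
  apply: inju; rewrite (subst_comp hS hW hu) (subst_crd hS hu).
  rewrite -[RHS](subst_id hS); apply: (subst_ext hS) => i; rewrite /W wu //.
  exact: (crd_maxid hS).
have Wl i : W (lshift d i) = crd (lshift d i).
  by rewrite -[RHS]Wu ul (subst_crd hS).
exists (fun j => restr (W (rshift n j))); split.
  by move=> j; rewrite /restr; apply: (maxid_subst hS (@maxid_restr_arg _ _ hS n d)).
move=> j; have /(congr1 (@restr _ S n d)) := Wu (rshift n j).
rewrite ur restr_crdr // /restr (subst_comp hS hW (@maxid_restr_arg _ _ hS n d)) => e0.
rewrite -[RHS]e0.
apply: (subst_ext hS) => a.
  case: split => ?; first exact: (crd_maxid hS).
  by rewrite /restr; apply: (maxid_subst hS (@maxid_restr_arg _ _ hS n d)); apply: hW.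
case: (splitP a) => [i|j'] ha.
  have -> : a = lshift d i by apply: val_inj.
  by rewrite Wl -/(restr _) restr_crdl.
by have -> : a = rshift n j' by apply: val_inj.
Qed.

Section Division.
Variables (n d : nat) (P : S n.+1).
Hypothesis P0 : forall e, (e < d)%N -> taylor P (U_(ord0) *+ e)%MM = 0.
Hypothesis P1 : taylor P (U_(ord0) *+ d)%MM != 0.

Let T := (n.+1 + d)%N.
Let t0 : 'I_T := ord0.
Let sx : 'I_(n + d) -> 'I_T := lift ord0.

Let sx_inj : injective sx. Proof. exact: lift_inj. Qed.
Let sx0 j : sx j != t0. Proof. by rewrite eq_sym neq_lift. Qed.

(** Taylor coefficients of the right-hand side of a generic division; since r_i
    does not involve t, only the r_i with i the exponent of t contributes. *)
Lemma taylor_division (h : S T) (r : 'I_d -> S T) (c : 'X_{1..T}) :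
  (forall i, fun_of sx (r i)) ->
  taylor (h * generic_poly S n d + \sum_(i < d) r i * crd t0 ^+ i) c =
  (if (d <= c t0)%N then taylor h (c - U_(t0) *+ d)%MM else 0) +
  \sum_(j < d) (if (0 < c (rshift n.+1 j))%N && (d.-1 - j <= c t0)%N
     then taylor h (c - U_(rshift n.+1 j) - U_(t0) *+ (d.-1 - j))%MM else 0) +
  \sum_(i < d | (i : nat) == c t0) taylor (r i) (c - U_(t0) *+ i)%MM.
Proof.
move=> hr; rewrite (taylor_add hS) /generic_poly mulrDr (taylor_add hS) mulrC.
rewrite (taylor_crdXM hS); congr (_ + _ + _).
  rewrite mulr_sumr (taylor_sum hS); apply: eq_bigr => j _.
  rewrite mulrCA (taylor_crdM hS) mulrC (taylor_crdXM hS) mnmBE mnm1E.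
  by rewrite -val_eqE /= subn0; case: ifP.
rewrite (taylor_sum hS) [RHS]big_mkcond; apply: eq_bigr => i _.
rewrite mulrC (taylor_crdXM hS); case: eqP => [->|hne]; first by rewrite leqnn.
case: leqP => // hle; apply: (taylor_out hS sx_inj (hr i) sx0).
by rewrite mnmBE mulmnE mnm1E eqxx mul1n; lia.
Qed.

(** Generic division of [P] itself. Comparing the coefficients of t^e gives
    rho_e(0) = 0 for e < d and h(0) = P_d, where P_d is the coefficient of t^d.
    Comparing those of t^e y_j, which vanish in P, gives
    d rho_e / d y_j (0) = 0 for e + j < d - 1 and - h(0) for e + j = d - 1. *)
Lemma generic_weierstrass : exists (h : S T) (rho : 'I_d -> S (n + d)%N),
  [/\ incl (lshift d) P = h * generic_poly S n d + \sum_(i < d) incl sx (rho i) * crd t0 ^+ i,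
      at0 h != 0, forall i, maxid (rho i)
    & \det (\matrix_(i < d, j < d) taylor (rho i) U_(rshift n j)%MM) != 0].
Proof.
have [h [r [hr E]]] := generic_division hS d P.
have injl : injective (lshift d : 'I_n.+1 -> 'I_T) by apply: lshift_inj.
have cP e : taylor (incl (lshift d : _ -> 'I_T) P) (U_(t0) *+ e)%MM = taylor P (U_(ord0) *+ e)%MM.
  rewrite -(taylor_incl hS P _ injl) mnm_pushMn mnm_push1; congr (taylor _ (U_(_) *+ _)%MM).
have Ut0 e : (U_(t0) *+ e)%MM t0 = e by rewrite mulmnE mnm1E eqxx mul1n.
have Uy e j : (U_(t0) *+ e)%MM (rshift n.+1 j) = 0%N by rewrite mulmnE mnm1E -val_eqE.
have E0 e : (e <= d)%N -> taylor P (U_(ord0) *+ e)%MM = (if e == d then at0 h else 0) +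
    \sum_(i < d | (i : nat) == e) at0 (r i).
  move=> led; rewrite -cP E taylor_division // Ut0 [X in _ + X + _]big1 ?addr0; last first.
    by move=> j _; rewrite Uy.
  congr (_ + _); last first.
    apply: eq_bigr => i /eqP ->; congr (taylor _ _).
    by apply/mnmP=> j; rewrite mnmBE subnn mnm0E.
  have [->|hne] := eqVneq e d.
    by rewrite leqnn /at0; congr (taylor _ _); apply/mnmP=> j; rewrite mnmBE subnn mnm0E.
  by case: leqP => // hle; lia.
have E1 (e j : 'I_d) :
    0 = (if (d.-1 - j <= e)%N then taylor h (U_(t0) *+ (e - (d.-1 - j)))%MM else 0)
    + taylor (r e) U_(rshift n.+1 j)%MM.
  have yt : (rshift n.+1 j == t0) = false by rewrite -val_eqE.
  pose c := (U_(t0) *+ e + U_(rshift n.+1 j))%MM.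
  have ct : c t0 = e by rewrite mnmDE Ut0 mnm1E yt addn0.
  have cy (j' : 'I_d) : c (rshift n.+1 j') = (j == j').
    by rewrite mnmDE Uy mnm1E (inj_eq (@rshift_inj _ _)).
  have := taylor_division h c hr; rewrite -E.
  have -> : taylor (incl (lshift d : _ -> 'I_T) P) c = 0.
    apply: (taylor_out hS injl) (_ : (0 < c (rshift n.+1 j))%N); first by exists P.
      by move=> i; rewrite eq_lrshift.
    by rewrite cy eqxx.
  rewrite ct leqNgt ltn_ord /= add0r => e0; rewrite [LHS]e0; congr (_ + _).
    rewrite (bigD1 j) //= cy eqxx big1 ?addr0 => [|j' hj']; last first.
      by rewrite cy eq_sym (negPf hj').
    rewrite /=; case: ifP => // hle; congr (taylor _ _); apply/mnmP=> i.
    rewrite !(mnmBE, mnmDE, mulmnE, mnm1E).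
    by case: eqP => [<-|_]; rewrite ?yt /=; lia.
  rewrite (bigD1 e) //= big1 ?addr0 => [|i /andP[/eqP/val_inj -> ]]; last by rewrite eqxx.
  by congr (taylor _ _); rewrite /c addmC addmK.
have [rho hrho] : exists rho : 'I_d -> S (n + d)%N, forall i, r i = incl sx (rho i).
  exact: fin_all_exists hr.
have h0 : at0 h != 0.
  move: P1; rewrite E0 // eqxx big1 ?addr0 // => i /eqP hi.
  by have := ltn_ord i; rewrite hi ltnn.
exists h, rho; split => //.
- by rewrite E; congr (_ + _); apply: eq_bigr => i _; rewrite hrho.
- move=> i; apply/(maxid_at0 hS); rewrite -(at0_subst hS (maxid_crd hS sx)) -/(incl sx _) -hrho.
  have := P0 (ltn_ord i); rewrite E0 1?ltnW // (negPf (_ : (i : nat) != d)); last first.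
    by have := ltn_ord i; lia.
  rewrite add0r (bigD1 i) //= big1 ?addr0 // => j /andP[/eqP hj hji].
  by case/eqP: hji; apply: val_inj.
(* reversing the rows makes the Jacobian matrix triangular *)
pose J := \matrix_(i < d, j < d) taylor (rho (rev_ord i)) U_(rshift n j)%MM.
have eJ (i j : 'I_d) : taylor (rho i) U_(rshift n j)%MM = taylor (r i) U_(rshift n.+1 j)%MM.
  rewrite hrho -(taylor_incl hS _ _ sx_inj) mnm_push1; congr (taylor _ U_(_)%MM).
  exact: val_inj.
have detJ : \det J != 0.
  rewrite -det_tr det_trig.
    apply/prodf_neq0 => i _; rewrite !mxE eJ.
    have := E1 (rev_ord i) i; rewrite /= (_ : (d.-1 - i <= d - i.+1)%N); last by lia.
    rewrite (_ : (d - i.+1 - (d.-1 - i))%N = 0%N) ?mulm0n; last by lia.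
    move/eqP; rewrite eq_sym addrC addr_eq0 => /eqP ->.
    by rewrite oppr_eq0.
  apply/is_trig_mxP => i j hij; rewrite !mxE eJ.
  have := E1 (rev_ord j) i; rewrite /= (_ : (d.-1 - i <= d - j.+1)%N = false) ?add0r //.
  have := ltn_ord j; lia.
apply: contraNneq detJ => /eqP/det0P[v v0 hv]; apply/det0P.
exists (\row_i v 0 (rev_ord i)).
  apply: contra v0 => /eqP/rowP h1; apply/eqP/rowP => i.
  by have := h1 (rev_ord i); rewrite !mxE rev_ordK.
apply/rowP=> j; have /rowP/(_ j) := hv; rewrite !mxE => hj.
rewrite -[RHS]hj [RHS](reindex_inj rev_ord_inj).
by apply: eq_bigr => i _; rewrite !mxE.
Qed.

(** Solve rho(x, Y(x)) = 0 and substitute y = Y(x) in the generic divisions of [P]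
    and of [g]: [P] becomes h times the Weierstrass polynomial P^d(t, Y(x)), with
    h a unit, and [g] is divided by that polynomial. *)
Theorem weierstrass (g : S n.+1) : exists (h : S n.+1) (r : 'I_d -> S n),
  g = h * P + \sum_(i < d) incl (lift ord0) (r i) * crd ord0 ^+ i.
Proof.
have [h [rho [E h0 hrho hdet]]] := generic_weierstrass.
have [Y [hY rY]] := implicit_fun hrho hdet.
set G := fun a : 'I_(n + d) => _ in rY.
pose G' (a : 'I_T) : S n.+1 :=
  match split a with inl i => crd i | inr j => incl (lift ord0) (Y j) end.
have hG a : maxid (G a) by rewrite /G; case: split => // i; apply: (crd_maxid hS).
have hG' a : maxid (G' a).
  rewrite /G'; case: split => i; first exact: (crd_maxid hS).
  by apply: (maxid_subst hS) => //; apply: maxid_crd.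
have G't : G' t0 = crd ord0.
  have -> : t0 = lshift d ord0 by apply: val_inj.
  by rewrite /G' (unsplitK (inl ord0)).
have sl f : subst G' (incl (lshift d) f) = f.
  rewrite /incl (subst_comp hS) //; last exact: maxid_crd.
  rewrite -[RHS](subst_id hS); apply: (subst_ext hS) => i.
    by apply: (maxid_subst hS) => //; apply: maxid_crd.
  by rewrite (subst_crd hS) // /G' (unsplitK (inl i)).
have ssx f : subst G' (incl sx f) = incl (lift ord0) (subst G f).
  rewrite /incl (subst_comp hS) //; last exact: maxid_crd.
  rewrite (subst_comp hS) //; last exact: maxid_crd.
  apply: (subst_ext hS) => i.
    by apply: (maxid_subst hS) => //; apply: maxid_crd.
  rewrite (subst_crd hS) // /G' /G; case: (splitP i) => j hj.
    have -> : sx i = lshift d (lift ord0 j) by apply: val_inj; rewrite /= hj.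
    by rewrite (unsplitK (inl _)) (subst_crd hS) //; apply: maxid_crd.
  have -> : sx i = rshift n.+1 j by apply: val_inj; rewrite /= hj.
  by rewrite (unsplitK (inr _)).
have sdiv g' h' (r' : 'I_d -> S (n + d)%N) :
    incl (lshift d) g' = h' * generic_poly S n d + \sum_(i < d) incl sx (r' i) * crd t0 ^+ i ->
    g' = subst G' h' * subst G' (generic_poly S n d) +
      \sum_(i < d) incl (lift ord0) (subst G (r' i)) * crd ord0 ^+ i.
  move=> /(congr1 (subst G')); rewrite sl => ->; rewrite (substD hS hG') (substM hS hG').
  congr (_ + _); have sumG (F : 'I_d -> S T) :
      subst G' (\sum_(i < d) F i) = \sum_(i < d) subst G' (F i).
    by elim/big_rec2: _ => [|i x y _ <-]; [apply: (subst0 hS)|apply: (substD hS)].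
  rewrite sumG; apply: eq_bigr => i _; rewrite (substM hS hG') ssx; congr (_ * _).
  elim: (i : nat) => [|e IH]; first by rewrite (subst1 hS).
  by rewrite !exprS (substM hS hG') IH (subst_crd hS hG') G't.
have eP := sdiv _ _ _ E.
have [hg [rg [hrg Eg]]] := generic_division hS d g.
have [rhog hrhog] : exists rho : 'I_d -> S (n + d)%N, forall i, rg i = incl sx (rho i).
  exact: fin_all_exists hrg.
have eg : incl (lshift d) g = hg * generic_poly S n d + \sum_(i < d) incl sx (rhog i) * crd t0 ^+ i.
  by rewrite Eg; congr (_ + _); apply: eq_bigr => i _; rewrite hrhog.
exists (subst G' hg / subst G' h), (fun i => subst G (rhog i)).
rewrite {1}(sdiv _ _ _ eg); congr (_ + _).
rewrite {1}eP [\sum_(i < d) _]big1 ?addr0; last first.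
  by move=> i _; rewrite rY inclE rmorph0 mul0r.
by rewrite mulrA divrK // (unit_at0 hS) (at0_subst hS hG').
Qed.

End Division.
End Weierstrass.

(** * Nakayama's lemma and a preparation theorem *)
Section DetIdeal.
Variable R : comNzRingType.

Lemma det_mod_ideal (I : R -> Prop) q (A B : 'M[R]_q) : is_ideal I ->
  (forall i j, I (A i j - B i j)) -> I (\det A - \det B).
Proof.
move=> hI hAB; case: (hI) => h0 hD hM.
rewrite /determinant -sumrB; apply: ideal_sum => // s _.
rewrite -mulrBr; apply: (hM).
elim/big_rec2: _ => [|i x y _ h]; first by rewrite subrr.
have -> : A i (s i) * y - B i (s i) * x =
   A i (s i) * (y - x) + x * (A i (s i) - B i (s i)).
  by ring.
by apply: hD; apply: (hM).
Qed.

End DetIdeal.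

Section Modules.
Variables (K : fieldType) (S : smooth_data K).
Hypothesis hS : smooth_category S.
Variable N : nat.
Local Notation R := (S N).

(** The modules of interest are quotients of the one ring R = S N by subgroups
    M that are stable under a subring S p of R. Working with predicates on R
    modulo M avoids quotient types and changes of base rings: S p acts through
    the inclusion given by [s]. *)
Definition submod p (s : 'I_p -> 'I_N) (M : R -> Prop) : Prop :=
  [/\ M 0, forall x y, M x -> M y -> M (x + y)
    & forall a x, M x -> M (incl s a * x)].

Definition addspan p (s : 'I_p -> 'I_N) (M : R -> Prop) (T : finType) (e : T -> R) (x : R) : Prop :=
  exists a : T -> S p, M (x - \sum_i incl s (a i) * e i).

Definition fgen p (s : 'I_p -> 'I_N) (M : R -> Prop) : Prop :=
  exists (T : finType) (g : T -> R), forall x, addspan s M g x.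

Section OneRing.
Variables (p : nat) (s : 'I_p -> 'I_N) (M : R -> Prop).
Hypothesis hM : submod s M.

Lemma submod_sum (T : Type) (r : seq T) (P : pred T) F :
  (forall i, P i -> M (F i)) -> M (\sum_(i <- r | P i) F i).
Proof. by case: hM => h0 hD _ h; elim/big_ind: _. Qed.

Lemma addspan_submod (T : finType) (e : T -> R) : submod s (addspan s M e).
Proof.
case: hM => h0 hD hZ; split.
- by exists (fun=> 0); rewrite sub0r big1 ?oppr0 // => i _; rewrite inclE rmorph0 mul0r.
- move=> x y [a ha] [b hb]; exists (fun i => a i + b i).
  rewrite (_ : _ - _ = (x - \sum_i incl s (a i) * e i) + (y - \sum_i incl s (b i) * e i)).
    exact: hD.
  rewrite addrACA -opprD -big_split; congr (_ - _); apply: eq_bigr => i _.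
  by rewrite inclE rmorphD mulrDl.
- move=> c x [a ha]; exists (fun i => c * a i).
  rewrite (_ : _ - _ = incl s c * (x - \sum_i incl s (a i) * e i)); first exact: hZ.
  rewrite mulrBr mulr_sumr; congr (_ - _); apply: eq_bigr => i _.
  by rewrite inclE rmorphM mulrA.
Qed.

Lemma addspan_sub (T : finType) (e : T -> R) x : M x -> addspan s M e x.
Proof.
move=> hx; exists (fun=> 0); rewrite big1 ?subr0 // => i _.
by rewrite inclE rmorph0 mul0r.
Qed.

(** Cayley--Hamilton, in the form of the determinant trick. *)
Lemma det_annihilates q (X : 'M[S p]_q) (g : 'I_q -> R) :
  (forall i, M (\sum_j incl s (X i j) * g j)) -> forall i, M (incl s (\det X) * g i).
Proof.
move=> hX i; pose f := inclr hS s; pose G : 'cV[R]_q := \col_j g j.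
have : (map_mx f (\adj X) *m (map_mx f X *m G)) i 0 = f (\det X) * g i.
  by rewrite mulmxA -map_mxM mul_adj_mx map_scalar_mx mul_scalar_mx !mxE.
rewrite -[incl s _]/(f _) => <-; rewrite mxE; apply: submod_sum => k _.
case: hM => _ _ hZ; rewrite mxE; apply: hZ; rewrite mxE.
rewrite (eq_bigr (fun j => incl s (X k j) * g j)) // => j _.
by rewrite !mxE.
Qed.

End OneRing.

Section Nakayama.
Variables (p : nat) (s : 'I_p -> 'I_N) (M : R -> Prop).
Hypothesis hM : submod s M.

(** The generators of R modulo M satisfy (1 - Z) g = 0 modulo M and the [e i],
    with Z a matrix over the maximal ideal, and det (1 - Z) is a unit. *)
Lemma nakayama (T : finType) (e : T -> R) : fgen s M ->
  (forall x, exists y : 'I_p -> R, addspan s M e (x - \sum_l crd (s l) * y l)) ->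
  forall x, addspan s M e x.
Proof.
move=> [T' [g hg]] he.
have hM' := addspan_submod hM e; set M' := addspan s M e in he hM' *.
pose g' (i : 'I_#|T'|) := g (enum_val i).
have hg' x : addspan s M' g' x.
  have [a ha] := hg x; exists (a \o enum_val); apply: addspan_sub.
  by rewrite (reindex (enum_val (A := T'))) in ha; last exact: onW_bij (enum_val_bij T').
suff hgM i : M' (g' i).
  move=> x; have [a ha] := hg' x; rewrite -[x](subrK (\sum_i incl s (a i) * g' i)).
  case: (hM') => _ hD hZ; apply: hD => //.
  by apply: (submod_sum hM') => j _; apply: hZ.
have hZ0 i0 : exists Zi : 'I_#|T'| -> S p,
    (forall j, maxid (Zi j)) /\ M' (g' i0 - \sum_j incl s (Zi j) * g' j).
  have [y hy] := he (g' i0).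
  have [a ha] := fin_all_exists (fun l => hg' (y l)).
  exists (fun j => \sum_l crd l * a l j); split=> [j|].
    apply: (ideal_sum (maxid_ideal hS p)) => l _.
    by apply: (ideal_mulr (maxid_ideal hS p)); apply: (crd_maxid hS).
  rewrite (_ : _ - _ = (g' i0 - \sum_l crd (s l) * y l)
     + \sum_l incl s (crd l) * (y l - \sum_j incl s (a l j) * g' j)).
    case: (hM') => h0 hD hZ; apply: hD => //.
    by apply: (submod_sum hM') => l _; apply: hZ.
  rewrite -addrA; congr (_ + _).
  rewrite [X in _ = _ + X](eq_bigr
    (fun l => crd (s l) * y l - \sum_j incl s (crd l * a l j) * g' j)); last first.
    move=> l _; rewrite mulrBr incl_crd // mulr_sumr; congr (_ - _); apply: eq_bigr => j _.
    by rewrite [in RHS]inclE rmorphM /= /inclr incl_crd // mulrA.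
  rewrite sumrB addKr exchange_big; congr (- _); apply: eq_bigr => j _.
  by rewrite inclE raddf_sum mulr_suml.
have [Z hZ] := fin_all_exists hZ0.
pose X : 'M[S p]_#|T'| := \matrix_(i, j) ((i == j)%:R - Z i j).
have detX : \det X \is a GRing.unit.
  rewrite (unit_at0 hS) -[at0 _]/(at0r hS _) -det_map_mx.
  rewrite (_ : map_mx _ _ = 1%:M) ?det1 ?oner_neq0 //.
  apply/matrixP=> a b; rewrite !mxE rmorphB rmorph_nat /=.
  by have [/(_ b)/(maxid_at0 hS) h _] := hZ a; rewrite /at0r h subr0.
have hXg a : M' (\sum_j incl s (X a j) * g' j).
  rewrite (_ : \sum_j _ = g' a - \sum_j incl s (Z a j) * g' j); first by case: (hZ a).
  rewrite (eq_bigr (fun j => (a == j)%:R * g' j - incl s (Z a j) * g' j)); last first.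
    by move=> j _; rewrite mxE inclE rmorphB rmorph_nat mulrBl.
  rewrite sumrB (bigD1 a) //= eqxx mul1r big1 ?addr0 // => j hj.
  by rewrite eq_sym (negPf hj) mul0r.
have := det_annihilates hM' hXg i; case: (hM') => _ _ hZ' /(hZ' (\det X)^-1).
by rewrite mulrA !inclE -rmorphM mulVr // rmorph1 mul1r.
Qed.

End Nakayama.
End Modules.

(** In this section, A = S p.+1 acts on R through [s], with distinguished
    coordinate t, and B = S p is the subring of A of the functions of the other
    coordinates, whose images in R are the [xx l]. The exponent r.+1, for r
    elements e_i, leaves unchanged the coefficients of degree at most r of a
    characteristic polynomial. *)
Section Malgrange.
Variables (K : fieldType) (S : smooth_data K).
Hypothesis hS : smooth_category S.
Variables (N p : nat) (s : 'I_p.+1 -> 'I_N) (M : S N -> Prop).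
Hypothesis hM : submod s M.
Hypothesis hfg : fgen s M.
Local Notation R := (S N).
Local Notation t := (crd (s ord0)).
Local Notation xx l := (crd (s (lift ord0 l))).
Local Notation fA := (inclr hS s).
Local Notation fB := (inclr hS (s \o lift ord0)).
Variables (r : nat) (e : 'I_r -> R).
Hypothesis he : forall x, exists (k : 'I_r -> K) (y0 : R) (y : 'I_p -> R),
  M (x - \sum_i k i *: e i - t ^+ r.+1 * y0 - \sum_(l < p) xx l * y l).

Let spanA x : addspan s M e x.
Proof.
apply: (nakayama hS hM hfg) => {}x; have [k [y0 [y hy]]] := he x.
exists (fun l => if unlift ord0 l is Some l' then y l' else t ^+ r * y0).
exists (fun i => (k i)%:A); rewrite big_ord_recl unlift_none.
rewrite (eq_bigr (fun l : 'I_p => xx l * y l)); last by move=> l _; rewrite liftK.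
rewrite [X in M X](_ : _ = x - \sum_i k i *: e i - t ^+ r.+1 * y0 - \sum_(l < p) xx l * y l) //.
rewrite [X in _ - X = _](eq_bigr (fun i => k i *: e i)).
  by rewrite exprS; ring.
by move=> i _; rewrite /incl (substC hS (maxid_crd hS s)) -scalerAl mul1r.
Qed.

(** On the t-axis, multiplication by [h] acts on the lowest term as h(0). *)
Lemma taylor_axis q (P h : S q.+1) c : (forall b, (b < c)%N -> taylor P (U_(ord0) *+ b)%MM = 0) ->
  taylor (h * P) (U_(ord0) *+ c)%MM = at0 h * taylor P (U_(ord0) *+ c)%MM.
Proof.
move=> hP; rewrite (taylor_mul hS) (bigD1 bm0) /=; last by apply/mnm_lepP=> i; rewrite mnm0E.
rewrite subm0 big1 ?addr0 // => b /andP[/mnm_lepP hb hb0].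
have eb : (U_(ord0) *+ c - b)%MM = (U_(ord0) *+ (c - b ord0))%MM.
  apply/mnmP=> i; move: (hb i); rewrite mnmBE !mulmnE mnm1E.
  by case: eqP => [<-|_]; rewrite ?mul1n // !mul0n leqn0 => /eqP ->.
rewrite eb hP ?mulr0 //.
have hb0' : (0 < b ord0)%N.
  rewrite lt0n; apply: contra hb0 => /eqP h0; apply/eqP/val_inj/mnmP => i /=.
  move: (hb i); rewrite mnm0E mulmnE mnm1E; case: eqP => [<- //|_].
  by rewrite mul0n leqn0 => /eqP.
by have := hb ord0; rewrite mulmnE mnm1E eqxx mul1n; lia.
Qed.

Lemma taylor_poly q (P : {poly K}) c :
  taylor (horner_alg (crd ord0 : S q.+1) P) (U_(ord0) *+ c)%MM = P`_c.
Proof.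
elim/poly_ind: P c => [|P k IH] c; first by rewrite rmorph0 (taylor0 hS) coef0.
rewrite rmorphD rmorphM /= horner_algX horner_algC mulrC (taylor_add hS) (taylor_crdM hS).
rewrite (taylorC hS) /fpsC coefD coefMX coefC mulmnE mnm1E eqxx mul1n lt0n -mdeg_eq0.
rewrite mdegMn mdeg1 mul1n; case: eqP => //= hc; case: c hc => // c _.
congr (_ + _); rewrite -IH; congr (taylor _ _); apply/mnmP=> i.
by rewrite mnmBE !mulmnE mnm1E; case: eqP => _ /=; lia.
Qed.

(** Modulo M, multiplication by t acts on the e_i as C + t^(r+1) Y + Z, where C is
    a matrix over K and the entries of Z lie in the ideal of the [xx l]. P is the
    determinant of t - C - t^(r+1) Y - Z; on the t-axis and up to degree r it
    agrees with the characteristic polynomial of C, which is monic of degree r. So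
    P is regular in t. *)
Lemma char_annihilator : exists P : S p.+1,
  (forall i, M (incl s P * e i)) /\ exists c, taylor P (U_(ord0) *+ c)%MM != 0.
Proof.
have [C hC] := fin_all_exists (fun i => he (t * e i)).
have [y0 hy0] := fin_all_exists hC.
have [y hy] := fin_all_exists hy0 => {hC hy0}.
have [Y hY] := fin_all_exists (fun i => spanA (y0 i)).
have hZ0 i := fin_all_exists (fun l => spanA (y i l)).
have [Z hZ] := fin_all_exists hZ0.
pose tA : S p.+1 := crd ord0.
pose Cm : 'M[K]_r := \matrix_(i, j) C i j.
pose X0 := map_mx (horner_alg tA) (char_poly_mx Cm).
pose W : 'M[S p.+1]_r := \matrix_(i, j) (tA ^+ r.+1 * Y i j + \sum_l crd (lift ord0 l) * Z i l j).
exists (\det (X0 - W)); split.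
  apply: (det_annihilates hS hM) => i; case: (hM) => M0 MD MZ.
  rewrite (_ : \sum_j _ =
     (t * e i - \sum_j C i j *: e j - t ^+ r.+1 * y0 i - \sum_(l < p) xx l * y i l)
     + fA (tA ^+ r.+1) * (y0 i - \sum_j fA (Y i j) * e j)
     + \sum_(l < p) fA (crd (lift ord0 l)) * (y i l - \sum_j fA (Z i l j) * e j)).
    apply: (MD); last by apply: (submod_sum hM) => l _; apply: (MZ); apply: hZ.
    by apply: (MD); [apply: hy|apply: (MZ); apply: hY].
  rewrite (eq_bigr (fun j => (i == j)%:R * (t * e j) - C i j *: e j -
     t ^+ r.+1 * (fA (Y i j) * e j) - \sum_(l < p) xx l * (fA (Z i l j) * e j))); last first.
    move=> j _; rewrite mxE [(- W) i j]mxE -[incl s _]/(fA _) rmorphB /=.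
    have -> : fA (X0 i j) = (i == j)%:R * t - (C i j)%:A.
      rewrite !mxE rmorphB rmorphMn /= horner_algX horner_algC rmorphB rmorphMn.
      rewrite /= /inclr incl_crd // /incl (substC hS (maxid_crd hS s)).
      by case: (i == j); rewrite ?mul1r ?mul0r.
    have -> : fA (W i j) = t ^+ r.+1 * fA (Y i j) + \sum_(l < p) xx l * fA (Z i l j).
      rewrite mxE rmorphD rmorphM rmorphXn raddf_sum /= /inclr incl_crd //.
      congr (_ + _); apply: eq_bigr => l _.
      by rewrite -[incl s _]/(fA _) rmorphM /= /inclr incl_crd.
    rewrite mulrBl mulrBl mulrDl -scalerAl mul1r opprD !addrA mulr_suml -!mulrA.
    by congr (_ - _); apply: eq_bigr => l _; rewrite mulrA.
  have ft : fA tA = t by rewrite /= /inclr incl_crd.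
  rewrite !sumrB -!mulr_sumr exchange_big /= rmorphXn /= ft.
  rewrite (bigD1 i) //= eqxx mul1r [\sum_(_ < r | _) _]big1 ?addr0; last first.
    by move=> j hj; rewrite eq_sym (negPf hj) mul0r.
  rewrite [X in _ = _ + X](eq_bigr (fun l => xx l * y i l - \sum_j xx l * (fA (Z i l j) * e j))).
    by rewrite sumrB; ring.
  by move=> l _; rewrite /= /inclr incl_crd // mulrBr mulr_sumr.
exists r.
(* contains t^(r+1) and the coordinates of B *)
pose I (f : S p.+1) := forall c, (c <= r)%N -> taylor f (U_(ord0) *+ c)%MM = 0.
have hI : is_ideal I.
  split=> [c _|f g hf hg c hc|f g hg c hc]; first exact: taylor0.
    by rewrite (taylor_add hS) hf // hg // addr0.
  rewrite taylor_axis ?hg ?mulr0 // => b hb; apply: hg; lia.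
have : I (\det (X0 - W) - \det X0).
  apply: det_mod_ideal => // i j.
  case: (hI) => _ hD hM'; rewrite !mxE addrAC subrr add0r; apply: (ideal_opp hI).
  have U0 c' : (U_(ord0 : 'I_p.+1) *+ c')%MM ord0 = c' by rewrite mulmnE mnm1E eqxx mul1n.
  apply: (hD).
    by move=> c hc; rewrite (taylor_crdXM hS) U0 leqNgt ltnS hc.
  apply: (ideal_sum hI) => l _ c hc; rewrite (taylor_crdM hS) mulmnE mnm1E.
  by rewrite (negPf (neq_lift _ _)).
move=> /(_ r (leqnn _)); rewrite (taylorB hS) => /eqP; rewrite subr_eq0 => /eqP ->.
rewrite det_map_mx taylor_poly -/(char_poly _).
have /monicP := char_poly_monic Cm; rewrite lead_coefE size_char_poly => -> .
exact: oner_neq0.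
Qed.

(** P annihilates the e_i, which span R over A by [nakayama]; so dividing the
    coefficients by P shows that the t^i e_j with i less than the order d of P span
    R over B. Dividing t^d by P leaves a remainder with coefficients in the maximal
    ideal of B, which gives the first assertion. *)
Lemma malgrange :
  (exists d, forall x, exists y : 'I_p -> R, M (t ^+ d * x - \sum_(l < p) xx l * y l)) /\
  fgen (s \o lift ord0) M.
Proof.
have [P [hP hc]] := char_annihilator.
have [d Pd mind] := ex_minnP hc.
have P0 b : (b < d)%N -> taylor P (U_(ord0) *+ b)%MM = 0.
  by move=> hb; apply/eqP/negPn/negP => /mind; lia.
have W := weierstrass hS P0 Pd; case: (hM) => M0 MD MZ.
split.
  exists d => x.
  have [h [rmd hr]] := W (crd ord0 ^+ d).
  have rr0 i : at0 (rmd i) = 0.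
    have Ut0 b : (U_(ord0 : 'I_p.+1) *+ b)%MM ord0 = b by rewrite mulmnE mnm1E eqxx mul1n.
    have := congr1 (fun F => taylor F (U_(ord0) *+ i)%MM) hr.
    rewrite -(mulr1 (_ ^+ _)) (taylor_crdXM hS) Ut0 leqNgt ltn_ord /=.
    rewrite (taylor_add hS) taylor_axis; last first.
      by move=> b hb; apply: P0; have := ltn_ord i; lia.
    rewrite (P0 _ (ltn_ord i)) mulr0 add0r (taylor_sum hS) (bigD1 i) //= big1 ?addr0 => [|j hj].
      rewrite mulrC (taylor_crdXM hS) Ut0 leqnn => /esym h0.
      move: h0; rewrite (_ : (_ - _)%MM = mnm_push (lift ord0 : 'I_p -> 'I_p.+1) 0%MM).
        by rewrite (taylor_incl hS) //; apply: lift_inj.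
      by rewrite mnm_push0; apply/mnmP=> l; rewrite mnmBE subnn mnm0E.
    rewrite mulrC (taylor_crdXM hS) Ut0; case: leqP => // hle.
    apply: (@taylor_out _ _ hS _ _ (lift ord0 : 'I_p -> _) _ _ ord0); first exact: lift_inj.
    - by exists (rmd j).
    - by move=> l; rewrite eq_sym neq_lift.
    rewrite mnmBE !Ut0 subn_gt0 ltn_neqAle hle andbT; apply: contra hj => /eqP h0.
    by apply/eqP/val_inj.
  have [a ha] := spanA x.
  have hdec i := maxid_decomp hS (rmd i).
  have [z hz] := fin_all_exists hdec.
  exists (fun l => \sum_i fB (z i l) * t ^+ i * x).
  rewrite (_ : _ - _ =
      fA h * (fA P * (x - \sum_i fA (a i) * e i) + \sum_i fA (a i) * (fA P * e i))).
    apply: (MZ); apply: (MD); first exact: MZ.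
    by apply: (submod_sum hM) => i _; apply: (MZ).
  have -> : t ^+ d = fA (crd ord0 ^+ d) by rewrite rmorphXn /= /inclr incl_crd.
  rewrite hr rmorphD rmorphM raddf_sum /=.
  have -> : \sum_i fA (incl (lift ord0) (rmd i) * crd ord0 ^+ i) =
      \sum_(l < p) xx l * \sum_i fB (z i l) * t ^+ i.
    rewrite (eq_bigr (fun i : 'I_d => \sum_(l < p) xx l * (fB (z i l) * t ^+ i))).
      by rewrite exchange_big; apply: eq_bigr => l _; rewrite mulr_sumr.
    move=> i _; rewrite rmorphM rmorphXn /= /inclr incl_comp // incl_crd //.
    rewrite hz rr0 scale0r add0r -[incl _ _]/(fB _) rmorph_sum mulr_suml.
    apply: eq_bigr => l _; rewrite rmorphM mulrA; congr (_ * _ * _).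
    by rewrite /= /inclr incl_crd.
  rewrite mulrDl mulr_suml [X in _ + X - _](eq_bigr
    (fun l => xx l * \sum_(i < d) fB (z i l) * t ^+ i * x)).
    rewrite addrK mulrBr mulr_sumr -mulrA; congr (_ * _).
    rewrite -addrA addrC -[LHS]add0r; congr (_ + _); apply/esym/eqP; rewrite addrC subr_eq0.
    by apply/eqP/eq_bigr => i _; rewrite !mulrA [fA P * _]mulrC.
  by move=> l _; rewrite -mulrA mulr_suml.
exists ('I_d * 'I_r)%type, (fun ij : 'I_d * 'I_r => t ^+ ij.1 * e ij.2) => x.
have [a ha] := spanA x.
have [h hh] := fin_all_exists (fun i => W (a i)); have [b hb] := fin_all_exists hh.
exists (fun ij => b ij.2 ij.1).
rewrite (_ : _ - _ = (x - \sum_i incl s (a i) * e i) + \sum_i incl s (h i) * (incl s P * e i)).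
  by apply: (MD) => //; apply: (submod_sum hM) => i _; apply: (MZ).
have key j : fA (a j) * e j - fA (h j) * (fA P * e j) =
    \sum_i fB (b j i) * (t ^+ i * e j).
  rewrite hb rmorphD rmorphM rmorph_sum mulrDl -mulrA addrAC subrr add0r mulr_suml.
  apply: eq_bigr => i _; rewrite rmorphM rmorphXn /= /inclr incl_comp // incl_crd //.
  by rewrite mulrA.
rewrite -addrA; congr (_ + _); rewrite -[RHS]opprK opprD opprK -sumrB; congr (- _).
rewrite (eq_bigr _ (fun j _ => key j)) exchange_big.
by rewrite (pair_big predT predT (fun i j => fB (b j i) * (t ^+ i * e j))).
Qed.

End Malgrange.

(** * Descent along the tower of subrings *)
Section Tails.
Variables (K : fieldType) (S : smooth_data K).
Hypothesis hS : smooth_category S.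
Variable N : nat.
Local Notation R := (S N).

Lemma tail_proof p j (h : (p + j)%N = N) (i : 'I_p) : (i + j < N)%N.
Proof. by rewrite -h ltn_add2r. Qed.

Definition tail p j (h : (p + j)%N = N) (i : 'I_p) : 'I_N := Ordinal (tail_proof h i).

Lemma tail_inj p j (h : (p + j)%N = N) : injective (tail h).
Proof. by move=> a b /(congr1 val) /= /addIn/val_inj. Qed.

Lemma tailP p j (h : (p + j)%N = N) (i : 'I_N) : (j <= i)%N -> exists l, i = tail h l.
Proof.
move=> hi; have hp : (i - j < p)%N by have := ltn_ord i; rewrite -{2}h; lia.
by exists (Ordinal hp); apply: val_inj; rewrite /= subnK.
Qed.

Lemma tail_out p j (h : (p + j)%N = N) (i : 'I_N) : (i < j)%N -> forall l, tail h l != i.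
Proof. by move=> hi l; rewrite -val_eqE /=; lia. Qed.

(** Membership in the subring of the functions of the coordinates x_j, x_(j+1), ..,
    phrased with derivatives: this makes sense for all [j] without casts between
    the types S (N - j), and is monotone in [j] by definition. *)
Definition sub j (f : R) : Prop :=
  forall (i : 'I_N) q, (i < j)%N -> (0 < q)%N -> hasse (U_(i) *+ q)%MM f = 0.

Lemma sub_fun_of p j (s : 'I_p -> 'I_N) f : injective s ->
  (forall i : 'I_N, (j <= i)%N <-> exists l, i = s l) -> fun_of s f <-> sub j f.
Proof.
move=> hs him; rewrite (incl_image hS hs f); split=> hf i q h1 h2; apply: hf => //.
  move=> l; apply/eqP=> e; have /him : exists l, i = s l by exists l.
  by rewrite leqNgt h1.
rewrite ltnNge; apply/negP=> /him [l e].
by move: (h1 l); rewrite e eqxx.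
Qed.

Lemma subP p j (h : (p + j)%N = N) f : fun_of (tail h) f <-> sub j f.
Proof.
apply: sub_fun_of; first exact: tail_inj.
move=> i; split=> [/(tailP h) //|[l ->]]; exact: leq_addl.
Qed.

Lemma sub_le j j' f : (j <= j')%N -> sub j' f -> sub j f.
Proof. by move=> hj hf i q hi; apply: hf; apply: leq_trans hj. Qed.

Lemma sub0 f : sub 0 f.
Proof. by []. Qed.

Section Closure.
Variables (j : nat) (hj : (j <= N)%N).
Let h : (N - j + j)%N = N := subnK hj.

Lemma subM f g : sub j f -> sub j g -> sub j (f * g).
Proof.
move=> /(subP h)[f' ->] /(subP h)[g' ->]; apply/(subP h); exists (f' * g').
by rewrite !inclE rmorphM.
Qed.

Lemma subD f g : sub j f -> sub j g -> sub j (f + g).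
Proof.
move=> /(subP h)[f' ->] /(subP h)[g' ->]; apply/(subP h); exists (f' + g').
by rewrite !inclE rmorphD.
Qed.

Lemma subC c : sub j c%:A.
Proof.
by apply/(subP h); exists c%:A; rewrite /incl (substC hS (maxid_crd hS (tail h))).
Qed.

Lemma sub_crd (i : 'I_N) : (j <= i)%N -> sub j (crd i).
Proof.
move=> /(tailP h)[l ->]; apply/(subP h); exists (crd l).
by rewrite incl_crd.
Qed.

Lemma sub_zero : sub j 0.
Proof. by rewrite -(scale0r 1); apply: subC. Qed.

Lemma subZ c f : sub j f -> sub j (c *: f).
Proof. by move=> hf; rewrite -mulr_algl; apply: subM => //; apply: subC. Qed.

Lemma sub_one : sub j 1.
Proof. by rewrite -(scale1r 1); apply: subC. Qed.

Lemma sub_mon (a : 'X_{1..N}) : (forall i : 'I_N, (i < j)%N -> a i = 0%N) -> sub j (mon S a).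
Proof.
move=> ha; rewrite /mon; elim/big_ind: _ => [||i _]; [exact: sub_one|exact: subM|].
case: (leqP j i) => [hi|/ha ->]; last exact: sub_one.
elim: (a i) => [|q IH]; first exact: sub_one.
by rewrite exprS; apply: subM => //; apply: sub_crd.
Qed.

End Closure.

Lemma fgen_ext p (s s' : 'I_p -> 'I_N) (M : R -> Prop) : s =1 s' -> fgen s M -> fgen s' M.
Proof.
move=> hs [T [g hg]]; exists T, g => x; have [a ha] := hg x; exists a.
by rewrite -(eq_bigr _ (fun i _ => congr1 ( *%R^~ (g i)) (incl_ext hS hs (a i)))).
Qed.

(** The q-th power of the ideal of R generated by the coordinates of index at
    least [j]. *)
Fixpoint xpow (j q : nat) (g : R) : Prop :=
  if q is q'.+1 then exists y : 'I_N -> R,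
    (forall i, xpow j q' (y i)) /\ g = \sum_(i < N | (j <= i)%N) crd i * y i
  else True.

Lemma xpowSP j q g : xpow j q.+1 g <-> exists y : 'I_N -> R,
    (forall i, xpow j q (y i)) /\ g = \sum_(i < N | (j <= i)%N) crd i * y i.
Proof. by []. Qed.

Lemma xpow_ideal j q : is_ideal (xpow j q).
Proof.
elim: q => [|q [h0 hD hM]]; first by split.
split.
- exists (fun=> 0); split; first by [].
  by rewrite big1 // => i _; rewrite mulr0.
- move=> f g /xpowSP[y [hy ->]] /xpowSP[z [hz ->]]; exists (fun i => y i + z i).
  split=> [i|]; first exact: hD.
  by rewrite -big_split; apply: eq_bigr => i _; rewrite mulrDr.
- move=> f g /xpowSP[y [hy ->]]; exists (fun i => f * y i).
  split=> [i|]; first exact: hM.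
  by rewrite mulr_sumr; apply: eq_bigr => i _; rewrite mulrCA.
Qed.

Lemma xpow_le j j' q g : (j <= j')%N -> xpow j' q g -> xpow j q g.
Proof.
move=> hj; elim: q g => // q IH g /xpowSP[y [hy ->]].
exists (fun i : 'I_N => if (j' <= i)%N then y i else 0); split=> [i|].
  by case: ifP => _; [apply: IH|case: (xpow_ideal j q)].
rewrite [RHS](bigID (fun i : 'I_N => (j' <= i)%N)) /= [X in _ = _ + X]big1 ?addr0.
  by apply: eq_big => [i|i ->] //; case: leqP => //= h1; rewrite ?andbF // (leq_trans hj).
by move=> i /andP[_ /negPf ->]; rewrite mulr0.
Qed.

Lemma xpowS j q (i : 'I_N) g : (j <= i)%N -> xpow j q g -> xpow j q.+1 (crd i * g).
Proof.
move=> hi hg; exists (fun i' => if i' == i then g else 0); split=> [i'|].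
  by case: ifP => // _; case: (xpow_ideal j q).
rewrite (bigD1 i) //= eqxx big1 ?addr0 // => i' /andP[_ /negPf ->].
by rewrite mulr0.
Qed.

Lemma xpow1P p j (h : (p + j)%N = N) g :
  xpow j 1 g <-> exists y : 'I_p -> R, g = \sum_l crd (tail h l) * y l.
Proof.
split=> [[y [_ ->]]|[y ->]]; last first.
  apply: (ideal_sum (xpow_ideal j 1)) => l _; apply: xpowS => //; exact: leq_addl.
exists (y \o tail h).
transitivity (\sum_(i in tail h @: [set: 'I_p]) crd i * y i).
  apply: eq_bigl => i; apply/idP/imsetP => [/(tailP h)[l ->]|[l _ ->]]; first by exists l.
  exact: leq_addl.
rewrite big_imset /=; last by move=> a b _ _; apply: tail_inj.
by apply: eq_bigl => i; rewrite inE.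
Qed.

Lemma sub_decomp j f : (j <= N)%N -> sub j f -> xpow j 1 (f - (at0 f)%:A).
Proof.
move=> hj; have h : (N - j + j)%N = N by rewrite subnK.
case/(subP h) => g ->; have [y hy] := maxid_decomp hS g.
rewrite {2}/incl (at0_subst hS (maxid_crd hS (tail h))).
rewrite {1}hy inclE rmorphD rmorph_sum /= /inclr /incl (substC hS (maxid_crd hS (tail h))).
rewrite -/(incl _ _) addrAC subrr add0r.
apply/(xpow1P h); exists (fun l => incl (tail h) (y l)).
by apply: eq_bigr => l _; rewrite -[subst _ _]/(inclr hS (tail h) _) rmorphM /= /inclr incl_crd.
Qed.

(** The elements e_i, to be taken with coefficients in the subring [sub (lev i)].
    Here [low j] is the part of R that the e_i of level less than [j] account for;
    it is a module over [sub j.-1], hence over [sub j]. The condition [approx j]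
    says that the e_i suffice up to any power of the ideal of the coordinates of
    index at least [j], modulo the coordinates of index at least [n]. *)
Section Tower.
Variables (n r : nat) (lev : 'I_r -> nat) (e : 'I_r -> R).
Hypothesis hn : (n <= N)%N.
Hypothesis hlev : forall i, (lev i <= n)%N.

Definition low j (x : R) : Prop := exists c : 'I_r -> R,
  (forall i, sub (lev i) (c i)) /\ x = \sum_(i | (lev i < j)%N) c i * e i.

Definition approx j : Prop := forall q x, exists (c : 'I_r -> R) (z w : R),
  [/\ forall i, sub (lev i) (c i), xpow j q z, xpow n 1 w & x = \sum_i c i * e i + z + w].

Let levN i : (lev i <= N)%N := leq_trans (hlev i) hn.

Lemma low_submod j j' p (h : (p + j')%N = N) : (j <= j'.+1)%N -> submod (tail h) (low j).
Proof.
move=> hj; split.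
- exists (fun=> 0); split; last by rewrite big1 // => i _; rewrite mul0r.
  by move=> i; apply: sub_zero.
- move=> x y [c [hc ->]] [c' [hc' ->]]; exists (fun i => c i + c' i); split.
    by move=> i; apply: subD.
  by rewrite -big_split; apply: eq_bigr => i _; rewrite mulrDl.
move=> a x [c [hc ->]]; have ha : sub j' (incl (tail h) a) by apply/(subP h); exists a.
exists (fun i => if (lev i <= j')%N then incl (tail h) a * c i else 0); split.
  move=> i; case: leqP => hi; last exact: sub_zero.
  by apply: subM => //; apply: sub_le ha.
rewrite mulr_sumr; apply: eq_bigr => i hi; rewrite (_ : (lev i <= j')%N) ?mulrA //.
by rewrite -ltnS (leq_trans hi).
Qed.

Lemma low_le j j' x : (j <= j')%N -> low j x -> low j' x.
Proof.
move=> hj [c [hc ->]]; exists (fun i => if (lev i < j)%N then c i else 0); split.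
  by move=> i; case: ifP => // _; apply: sub_zero.
rewrite [RHS](bigID (fun i => (lev i < j)%N)) /= [X in _ = _ + X]big1 ?addr0.
  apply: eq_big => [i|i ->] //; case: leqP => //= h1; first by rewrite andbF.
  by rewrite (leq_trans h1).
by move=> i /andP[_ /negPf ->]; rewrite mul0r.
Qed.

(** [malgrange] applies to A = [sub j], B = [sub j.+1] and M = [low j.+1]. Modulo M
    and the maximal ideal of B, the e_i of level greater than [j] only contribute
    their multiples by constants, and [approx j] with exponent r + 1 provides its
    hypothesis. Its first assertion converts high powers of the ideal of [sub j]
    into powers of the ideal of [sub j.+1], which gives [approx j.+1]. *)
Lemma tower_step p j (h : (p.+1 + j)%N = N) (h' : (p + j.+1)%N = N) : (j < n)%N ->
  approx j -> fgen (tail h) (low j) -> approx j.+1 /\ fgen (tail h') (low j.+1).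
Proof.
move=> hjn Hj Fj.
have hM := low_submod h (leqnn j.+1).
have Fj' : fgen (tail h) (low j.+1).
  case: Fj => T [g hg]; exists T, g => x; have [a ha] := hg x; exists a.
  exact: low_le ha.
have t_ext : tail h \o lift ord0 =1 tail h'.
  by move=> l; apply: val_inj; rewrite /= /bump /=; lia.
have tail0 : tail h ord0 = Ordinal (leq_trans hjn hn) by apply: val_inj.
have xdec q z : xpow j q z -> exists y0 z', xpow j.+1 1 z' /\ z = crd (tail h ord0) ^+ q * y0 + z'.
  elim: q z => [|q IH] z.
    move=> _; exists z, 0; rewrite mul1r addr0; split=> //.
    by case: (xpow_ideal j.+1 1).
  case/xpowSP=> y [hy ->]; have [y0 [z' [hz' ez]]] := IH _ (hy (tail h ord0)).
  have [I0 ID IM] := xpow_ideal j.+1 1.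
  exists y0, (crd (tail h ord0) * z' + \sum_(i < N | (j < i)%N) crd i * y i); split.
    apply: ID; first exact: IM.
    by apply: (ideal_sum (xpow_ideal j.+1 1)) => i hi; apply: xpowS.
  rewrite (bigD1 (tail h ord0)) //= ez mulrDr exprS mulrA -addrA; congr (_ + (_ + _)).
  apply: eq_bigl => i; rewrite -val_eqE /= add0n.
  by rewrite [RHS]ltn_neqAle eq_sym andbC.
pose e' i := if (j < lev i)%N then e i else 0.
have he x : exists (k : 'I_r -> K) (y0 : R) (y : 'I_p -> R),
   low j.+1 (x - \sum_i k i *: e' i - crd (tail h ord0) ^+ r.+1 * y0
     - \sum_(l < p) crd (tail h (lift ord0 l)) * y l).
  have [c [z [w [hc hz hw ->]]]] := Hj r.+1 x.
  have [y0 [z' [hz' ->]]] := xdec _ _ hz.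
  have : xpow j.+1 1 (\sum_(i | (j < lev i)%N) (c i - (at0 (c i))%:A) * e i + z' + w).
    have [_ ID _] := xpow_ideal j.+1 1; apply: (ID); last exact: xpow_le hw.
    apply: (ID) => //; apply: (ideal_sum (xpow_ideal j.+1 1)) => i hi.
    by apply: (ideal_mulr (xpow_ideal j.+1 1)); apply: xpow_le hi _; apply: sub_decomp.
  case/(xpow1P h') => y ey; exists (fun i => at0 (c i)), y0, y, c; split=> //.
  rewrite (eq_bigr (fun l => crd (tail h' l) * y l)) => [|l _]; last by rewrite -t_ext.
  rewrite -ey [\sum_i c i * e i](bigID (fun i => (lev i < j.+1)%N)) /=.
  rewrite [\sum_(i < r | ~~ _) _](eq_bigl (fun i => (j < lev i)%N)) => [|i]; last first.
    by rewrite -leqNgt.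
  rewrite [\sum_(i < r) _ *: _](_ : _ = \sum_(i | (j < lev i)%N) at0 (c i) *: e i); last first.
    rewrite [RHS]big_mkcond; apply: eq_bigr => i _; rewrite /e'.
    by case: ifP => // _; rewrite scaler0.
  have -> : \sum_(i | (j < lev i)%N) (c i - (at0 (c i))%:A) * e i =
      \sum_(i | (j < lev i)%N) c i * e i - \sum_(i | (j < lev i)%N) at0 (c i) *: e i.
    by rewrite -sumrB; apply: eq_bigr => i _; rewrite mulrBl -scalerAl mul1r.
  by ring.
have [[d hd] hfg] := malgrange hS hM Fj' he.
have hM' := low_submod h' (leqW (leqnn j.+1)).
split; last exact: fgen_ext t_ext hfg.
pose Q q (x : R) := exists v z, [/\ low j.+1 v, xpow j.+1 q z & x = v + z].
have Qlow q x : low j.+1 x -> Q q x.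
  by move=> hx; exists x, 0; rewrite addr0; split=> //; case: (xpow_ideal j.+1 q).
have QD q x y : Q q x -> Q q y -> Q q (x + y).
  case=> v [z [hv hz ->]] [v' [z' [hv' hz' ->]]]; exists (v + v'), (z + z').
  have [_ ID _] := xpow_ideal j.+1 q; have [_ MD _] := hM.
  by split; [exact: MD|exact: ID|rewrite addrACA].
have Qc q (i : 'I_N) x : (j < i)%N -> Q q x -> Q q.+1 (crd i * x).
  move=> hi [v [z [hv hz ->]]]; exists (crd i * v), (crd i * z).
  split; [|exact: xpowS|by rewrite mulrDr].
  have [l ->] := tailP h' hi; case: hM' => _ _ MZ.
  by rewrite -(incl_crd hS); apply: MZ.
have Q0 x : Q 0%N x.
  exists 0, x; split=> //; last by rewrite add0r.
  by case: hM.
have tlow b x : low j.+1 x -> low j.+1 (crd (tail h ord0) ^+ b * x).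
  case: hM => _ _ MZ hx; rewrite -(incl_crd hS) inclE -rmorphXn; exact: MZ.
have Qsum q (T : finType) (P : pred T) (F : T -> R) :
    (forall i, P i -> Q q (F i)) -> Q q (\sum_(i | P i) F i).
  move=> hF; elim/big_ind: _ => //; [|exact: QD].
  by apply: Qlow; case: hM.
have hQ q b x : (d * q <= b)%N -> Q q (crd (tail h ord0) ^+ b * x).
  elim: q b x => [|q IH] b x hb; first exact: Q0.
  have [y hy] := hd x; set m := \sum_l _ in hy.
  have -> : crd (tail h ord0) ^+ b * x = crd (tail h ord0) ^+ (b - d) *
      (crd (tail h ord0) ^+ d * x - m) + crd (tail h ord0) ^+ (b - d) * m.
    by rewrite -mulrDr subrK mulrA -exprD subnK //; lia.
  apply: QD; first by apply: Qlow; apply: tlow.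
  rewrite mulr_sumr; apply: Qsum => l _; rewrite mulrCA; apply: Qc.
    by rewrite /= /bump /=; lia.
  by apply: IH; lia.
(* trade the coordinates one at a time, each x_j for a power of t *)
have hQ2 s q b z : (d * q <= b + s)%N -> xpow j s z -> Q q (crd (tail h ord0) ^+ b * z).
  elim: s q b z => [|s IH] q b z; first by rewrite addn0 => hb _; apply: hQ.
  move=> hb /xpowSP[y [hy ->]]; rewrite mulr_sumr; apply: Qsum => i hi.
  have [ei|hij] := eqVneq i (tail h ord0).
    by rewrite ei mulrA -exprSr; apply: IH; rewrite ?addSnnS.
  case: q hb => [|q] hb; first exact: Q0.
  rewrite mulrCA; apply: Qc; last by apply: IH => //; nia.
  by rewrite ltn_neqAle hi andbT; apply: contra hij => /eqP ij; apply/eqP/val_inj.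
move=> q x; have [c [z [w [hc hz hw ->]]]] := Hj (d * q)%N x.
have [v [z' [[c' [hc' ->]] hz' ez]]] := hQ2 _ q 0%N _ (leqnn _) hz.
exists (fun i => if (lev i <= j)%N then c i + c' i else c i), z', w; split=> //.
  by move=> i; case: ifP => // _; apply: subD.
congr (_ + _); move: ez; rewrite mul1r => ->; rewrite addrA; congr (_ + _).
rewrite [X in _ + X]big_mkcond -big_split; apply: eq_bigr => i _ /=.
by rewrite ltnS; case: ifP => _; rewrite ?addr0 // mulrDl.
Qed.

(** At the top floor, Nakayama's lemma over [sub n] concludes. *)
Theorem tower : approx 0 -> forall x, exists c : 'I_r -> R,
  (forall i, sub (lev i) (c i)) /\ x = \sum_i c i * e i.
Proof.
move=> H0.
have main j : (j <= n)%N -> forall p (h : (p + j)%N = N), approx j /\ fgen (tail h) (low j).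
  elim: j => [|j IH] hj p h.
    split=> //; exists 'I_1, (fun=> 1) => x.
    have [g ->] := (subP h x).2 (sub0 x); exists (fun=> g).
    rewrite big_ord1 mulr1 subrr; by case: (low_submod h (leq0n 1)).
  have h1 : (p.+1 + j)%N = N by rewrite -h addSnnS.
  have [Hj Fj] := IH (ltnW hj) _ h1.
  exact: (tower_step (h := h1)).
have h : (N - n + n)%N = N by rewrite subnK.
have [Hn Fn] := main n (leqnn n) _ h.
have hM := low_submod h (leqnSn n).
pose e' i := if (n <= lev i)%N then e i else 0.
have spn : forall x, addspan (tail h) (low n) e' x.
  apply: (nakayama hS hM Fn) => x; have [c [z [w [hc hz hw ex]]]] := Hn 1%N x.
  have : xpow n 1 (z + w) by case: (xpow_ideal n 1) => _ hD _; apply: hD.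
  case/(xpow1P h) => y ey; exists y.
  have [a ha] : exists a : 'I_r -> S (N - n)%N,
      forall i, (n <= lev i)%N -> c i = incl (tail h) (a i).
    apply: (fin_all_exists (P := fun i a => (n <= lev i)%N -> c i = incl (tail h) a)) => i.
    case: (leqP n (lev i)) => hi; last by exists 0.
    by have [a ->] := (subP h (c i)).2 (sub_le hi (hc i)); exists a.
  exists a; exists c; split=> //.
  have -> : \sum_i incl (tail h) (a i) * e' i = \sum_(i | (n <= lev i)%N) c i * e i.
    rewrite [RHS]big_mkcond; apply: eq_bigr => i _; rewrite /e'.
    by case: ifP => [/ha -> //|_]; rewrite mulr0.
  rewrite -ey ex (bigID (fun i => (lev i < n)%N)) /=.
  rewrite [\sum_(i < r | ~~ _) _](eq_bigl (fun i => (n <= lev i)%N)) => [|i]; last first.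
    by rewrite -leqNgt.
  by ring.
move=> x; have [a [c [hc ex]]] := spn x.
exists (fun i => if (lev i < n)%N then c i else incl (tail h) (a i)); split.
  move=> i; case: ltnP => // hi; apply: sub_le (hlev i) _.
  by apply/(subP h); exists (a i).
move/eqP: ex; rewrite subr_eq => /eqP ->.
rewrite [X in X + _]big_mkcond -big_split; apply: eq_bigr => i _ /=; rewrite /e'.
by case: ltnP => _; rewrite ?mulr0 ?addr0 ?add0r.
Qed.

End Tower.
End Tails.

(** * Generation from graded pieces *)
Section Graded.
Variables (K : fieldType) (S : smooth_data K).
Hypothesis hS : smooth_category S.
Variables n m : nat.
Local Notation R := (S (n + m)%N).
Local Notation pu := (mnm_push (lshift m : 'I_n -> 'I_(n + m))).
Local Notation cu := (mnm_pull (lshift m : 'I_n -> 'I_(n + m))).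
Local Notation linj := (@lshift_inj n m).
Implicit Types a b : 'X_{1..n}.

Lemma umonE a : umon S m a = mon S (pu a).
Proof.
rewrite /mon big_split_ord /= [X in _ * X]big1 ?mulr1 => [|i _].
  by apply: eq_bigr => i _; rewrite mnm_push_in //; apply: linj.
by rewrite mnm_push_out // => j; rewrite eq_lrshift.
Qed.

Lemma umonD a b : umon S m (a + b)%MM = umon S m a * umon S m b.
Proof. by rewrite !umonE mnm_pushD monD. Qed.

Lemma umon1 (i : 'I_n) : umon S m U_(i)%MM = crd (lshift m i).
Proof. by rewrite umonE mnm_push1 mon1. Qed.

Lemma pu_le a b : (pu a <= pu b)%MM = (a <= b)%MM.
Proof.
apply/mnm_lepP/mnm_lepP => h i.
  by have := h (lshift m i); rewrite !mnm_push_in //; apply: linj.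
case: (splitP i) => j hj.
  have -> : i = lshift m j by apply: val_inj.
  by rewrite !(mnm_push_in linj).
by rewrite mnm_push_out // => l; rewrite -val_eqE /= hj neq_ltn (leq_trans (ltn_ord l)) // leq_addr.
Qed.

Lemma pu_sub a b : pu (a - b)%MM = (pu a - pu b)%MM.
Proof.
apply/mnmP=> i; rewrite mnmBE; case: (splitP i) => j hj.
  have -> : i = lshift m j by apply: val_inj.
  by rewrite !(mnm_push_in linj) mnmBE.
have -> : i = rshift n j by apply: val_inj.
by rewrite !mnm_push_out // => l; rewrite eq_lrshift.
Qed.

Lemma pu_below a (b : 'X_{1..n + m}) : (b <= pu a)%MM -> b = pu (cu b).
Proof.
move=> /mnm_lepP h; rewrite mnm_pullK //; first exact: linj.
by move=> j hj; apply/eqP; move: (h j); rewrite mnm_push_out // leqn0.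
Qed.

Definition uco (f : R) a : K := taylor f (pu a).

(** The restriction to v = 0 has order at least [q]. *)
Definition van q (f : R) : Prop := forall a, (mdeg a < q)%N -> uco f a = 0.

Lemma uco_umonM (g : 'X_{1..n}) f a :
  uco (umon S m g * f) a = if (g <= a)%MM then uco f (a - g)%MM else 0.
Proof. by rewrite /uco umonE (taylor_monM hS) pu_le -pu_sub. Qed.

Lemma uco_umon (g : 'X_{1..n}) a : uco (umon S m g) a = (g == a)%:R.
Proof.
rewrite /uco umonE (taylor_mon hS); congr (nat_of_bool _)%:R.
by apply/eqP/eqP => [/(congr1 cu)|->//]; rewrite !mnm_pushK //; apply: linj.
Qed.

Lemma van_mul q q' f g : van q f -> van q' g -> van (q + q')%N (f * g).
Proof.
move=> hf hg a ha; rewrite /uco (taylor_mul hS) big1 // => b hb.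
have hb' : (cu b <= a)%MM by rewrite -pu_le -(pu_below hb).
rewrite (pu_below hb) -pu_sub.
case: (ltnP (mdeg (cu b)) q) => hq; first by have := hf _ hq; rewrite /uco => ->; rewrite mul0r.
have hq' : (mdeg (a - cu b)%MM < q')%N by rewrite mdeg_sub //; have := mdeg_le hb'; lia.
by have := hg _ hq'; rewrite /uco => ->; rewrite mulr0.
Qed.

Lemma van0 f : van 0 f. Proof. by []. Qed.

Lemma van_mull q f g : van q g -> van q (f * g).
Proof. by move=> hg; have := van_mul (@van0 f) hg. Qed.

Lemma van_lin q c f g : van q f -> van q g -> van q (c *: f + g).
Proof.
move=> hf hg a ha; rewrite /uco (taylor_add hS) (taylorZ hS).
by rewrite [taylor f _]hf // [taylor g _]hg // mulr0 addr0.
Qed.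

Lemma van_ideal q : is_ideal (van q).
Proof.
split=> [a _|f g hf hg|f g hg]; first exact: taylor0; last exact: van_mull.
by rewrite -[f]scale1r; apply: van_lin.
Qed.

Lemma van_umon (g : 'X_{1..n}) : van (mdeg g) (umon S m g).
Proof.
move=> a ha; rewrite uco_umon; case: eqP => // e.
by rewrite e ltnn in ha.
Qed.

Lemma van_crd (i : 'I_n) : van 1 (crd (lshift m i)).
Proof. by rewrite -umon1 -(mdeg1 i); apply: van_umon. Qed.

Lemma van_crdr q (j : 'I_m) : van q (crd (rshift n j)).
Proof.
move=> a _; rewrite /uco (taylorX hS) /fpsX; case: eqP => // /mnmP/(_ (rshift n j)).
rewrite mnm1E eqxx mnm_push_out // => l; by rewrite eq_lrshift.
Qed.

Lemma uco_restr f a : taylor (restr f) a = uco f a.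
Proof.
have [y hy] := restr_decomp hS f.
rewrite -(taylor_incl hS _ _ linj) /uco {2}hy (taylor_add hS).
rewrite [X in _ + X](_ : _ = 0) ?addr0 //.
apply: (ideal_sum (van_ideal (mdeg a).+1)) (ltnSn _) => j _.
by apply: (ideal_mulr (van_ideal _)); apply: van_crdr.
Qed.

Lemma xpow_prod j q q' (f g : R) : xpow j q f -> xpow j q' g -> xpow j (q + q') (f * g).
Proof.
elim: q f => [|q IH] f; first by move=> _; case: (@xpow_ideal _ S (n + m) j q') => _ _; apply.
move=> /xpowSP[y [hy ->]] hg; rewrite mulr_suml.
apply: (ideal_sum (@xpow_ideal _ S (n + m) j _)) => i hi.
by rewrite -mulrA; apply: xpowS => //; apply: IH.
Qed.

Lemma xpow_maxid (f : R) : maxid f -> xpow 0 1 f.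
Proof.
move/(maxid_at0 hS) => h0; have := sub_decomp hS (leq0n _) (@sub0 _ _ _ f).
by rewrite h0 scale0r subr0.
Qed.

(** This converts the order at v = 0 into the ideal-theoretic language of [tower]. *)
Lemma van_xpow q f : van q f -> exists z w, [/\ xpow 0 q z, xpow n 1 w & f = z + w].
Proof.
move=> hf; have [y hy] := restr_decomp hS f.
exists (incl (lshift m) (restr f)), (\sum_(j < m) crd (rshift n j) * y j); split => //.
  have /(taylor_pow hS) : forall a, (mdeg a < q)%N -> taylor (restr f) a = 0.
    by move=> a ha; rewrite uco_restr; apply: hf.
  case=> [M [h [p [hp ->]]]]; rewrite inclE rmorph_sum /=.
  apply: (ideal_sum (@xpow_ideal _ S (n + m) 0 q)) => i _; rewrite rmorphM rmorph_prod /=.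
  case: (@xpow_ideal _ S (n + m) 0 q) => _ _; apply.
  elim: q p hp {hf h} => [|q IH] p hp; first by rewrite big_ord0.
  rewrite big_ord_recl; apply: (@xpow_prod 0 1 q).
    by apply: xpow_maxid; apply: (maxid_subst hS); [apply: maxid_crd|apply: hp].
  exact: (IH (fun i j => p i (lift ord0 j))).
apply: (ideal_sum (@xpow_ideal _ S (n + m) n 1)) => j _; apply: xpowS => //=; exact: leq_addr.
Qed.

Lemma van_rem q f : van q f ->
  van q.+1 (f - \sum_(a : 'X_{1..n < q.+1} | mdeg a == q) uco f a *: umon S m a).
Proof.
move=> hf a; rewrite ltnS /uco (taylorB hS) => ha.
rewrite (taylor_sum hS) (eq_bigr
  (fun b : 'X_{1..n < q.+1} => if val b == a then uco f a else 0)); last first.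
  move=> b _; rewrite (taylorZ hS) -/(uco (umon _ _ _) a) uco_umon.
  by case: eqP => [->|]; rewrite ?mulr1 ?mulr0.
have [haq|haq] := eqVneq (mdeg a) q.
  have hb : (mdeg a < q.+1)%N by rewrite haq.
  rewrite (bigD1 (BMultinom hb)) /=; last by rewrite haq.
  rewrite eqxx big1 ?addr0 ?subrr // => b /andP[_ /negPf hab].
  by rewrite -[val b == a](bmeqP b (BMultinom hb)) hab.
rewrite big1 ?subr0 => [|b /eqP hb]; last by case: eqP => // e'; rewrite -e' hb eqxx in haq.
by apply: hf; rewrite ltn_neqAle haq.
Qed.

Section Generators.
Variables (r d : nat) (lev deg : 'I_r -> nat) (e : 'I_r -> R).
Hypothesis hlev : forall i, (lev i <= n)%N.
Hypothesis hdeg : forall i, (deg i <= d)%N.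
Hypothesis he : forall i, van (deg i) (e i).

(** The functions whose part of degree [q] at v = 0 is a K-combination of the
    admissible multiples of the generators: monomials u^w times e_i with [w] in
    the variables allowed at the level of e_i. As an inductive predicate, it
    reduces statements on all such combinations to the multiples themselves. *)
Inductive gspan (q : nat) : R -> Prop :=
| gspan_high f : van q.+1 f -> gspan q f
| gspan_gen i (w : 'X_{1..n}) :
    (forall t : 'I_n, (t < lev i)%N -> w t = 0%N) -> (mdeg w + deg i)%N = q ->
    gspan q (umon S m w * e i)
| gspan_lin c f g : gspan q f -> gspan q g -> gspan q (c *: f + g).

Lemma gspan0 q : gspan q 0.
Proof. by apply: gspan_high => a _; apply: taylor0. Qed.

Lemma gspanD q f g : gspan q f -> gspan q g -> gspan q (f + g).
Proof. by move=> hf hg; rewrite -[f]scale1r; apply: gspan_lin. Qed.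

Lemma gspanZ q c f : gspan q f -> gspan q (c *: f).
Proof. by move=> hf; rewrite -[_ *: _]addr0; apply: gspan_lin => //; apply: gspan0. Qed.

Lemma gspan_sum q (T : Type) (s : seq T) (P : pred T) (F : T -> R) :
  (forall i, P i -> gspan q (F i)) -> gspan q (\sum_(i <- s | P i) F i).
Proof. by move=> h; elim/big_ind: _ => //; [apply: gspan0|apply: gspanD]. Qed.

Lemma van_gspan q : (forall a, mdeg a = q -> gspan q (umon S m a)) ->
  forall f, van q f -> gspan q f.
Proof.
move=> hq f hf.
rewrite -[f](subrK (\sum_(a : 'X_{1..n < q.+1} | mdeg a == q) uco f a *: umon S m a)).
apply: gspanD; last by apply: gspan_sum => a /eqP ha; apply: gspanZ; apply: hq.
by apply: gspan_high; apply: van_rem.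
Qed.

Hypothesis hbase : forall q a, (q <= d.+1)%N -> mdeg a = q -> gspan q (umon S m a).

(** Multiply u^w e_g by u_i. If u_i is not allowed for e_g, then write
    u^w = u_p u^w' with u_p allowed, so that p > i; such a p exists since
    |w| = q - deg e_g > 0. Then u_i u^w e_g = u_p (u_i u^w' e_g), where the second
    factor has degree q and is in the span by hypothesis; so a descending induction
    on i applies. *)
Lemma gspan_step q : (d < q)%N -> (forall f, van q f -> gspan q f) ->
  forall (i : 'I_n) f, gspan q f -> gspan q.+1 (crd (lshift m i) * f).
Proof.
move=> hq hall i; have [b] := ubnP (n - i); elim: b i => // b IH i hb f.
elim=> {f} [f hf|g w hw hdg|c f g _ hf _ hg].
- by apply: gspan_high; have := van_mul (@van_crd i) hf.
- case: (leqP (lev g) i) => hi.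
    rewrite mulrA -umon1 -umonD; apply: gspan_gen; last by rewrite mdegD mdeg1 -addnA hdg.
    move=> t ht; rewrite mnmDE (hw _ ht) mnm1E addn0; case: eqP => // e'.
    by move: (leq_trans ht hi); rewrite e' ltnn.
  have hw0 : w != 0%MM.
    by rewrite -mdeg_eq0; have := hdeg g; lia.
  have [p hp] := mnm_neq0 hw0.
  have [w' ew] : exists w', w = (U_(p) + w')%MM.
    by exists (w - U_(p))%MM; rewrite submKC // lep1mP -lt0n.
  have hip : (i < p)%N.
    apply: (leq_trans hi); rewrite leqNgt; apply/negP => /hw e0.
    by rewrite e0 in hp.
  rewrite ew umonD umon1 -mulrA mulrCA; apply: IH; first by have := ltn_ord p; lia.
  apply: hall; rewrite -hdg ew mdegD mdeg1 -addnA.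
  apply: van_mul; first exact: van_crd.
  by apply: van_mul => //; apply: van_umon.
by rewrite mulrDr -scalerAr; apply: gspan_lin.
Qed.

Lemma van_gspan_all q f : van q f -> gspan q f.
Proof.
move: f; apply: van_gspan; elim: q => [|q IH] a ha; first by apply: hbase.
case: (leqP q d) => hq; first by apply: hbase.
have ha0 : a != 0%MM by rewrite -mdeg_eq0 ha.
have [i hi] := mnm_neq0 ha0.
have hU : (U_(i) <= a)%MM by rewrite lep1mP -lt0n.
rewrite -(submKC hU) umonD umon1; apply: gspan_step => //; first exact: van_gspan.
by apply: IH; rewrite mdeg_sub // mdeg1 ha subn1.
Qed.

Lemma gspan_split q f : gspan q f -> exists c : 'I_r -> R,
  (forall i, sub (lev i) (c i)) /\ van q.+1 (f - \sum_i c i * e i).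
Proof.
have hln i : (lev i <= n + m)%N by apply: leq_trans (leq_addr _ _).
elim=> {f} [f hf|g w hw hdg|k f g _ [c [hc hf]] _ [c' [hc' hg]]].
- exists (fun=> 0); split; first by move=> i; apply: sub_zero.
  by rewrite big1 ?subr0 // => i _; rewrite mul0r.
- exists (fun i => if i == g then umon S m w else 0); split.
    move=> i; case: eqP => [->|_]; last exact: sub_zero.
    rewrite umonE; apply: sub_mon => // t ht.
    case: (splitP t) => j hj; last first.
      by move: ht; have := hlev g; lia.
    have -> : t = lshift m j by apply: val_inj.
    by rewrite (mnm_push_in linj) hw // -hj.
  rewrite (bigD1 g) //= eqxx big1 ?addr0 ?subrr => [a _|i /negPf ->]; last by rewrite mul0r.
  exact: taylor0.
exists (fun i => k *: c i + c' i); split.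
  by move=> i; apply: subD => //; apply: subZ.
rewrite (_ : _ - _ = k *: (f - \sum_i c i * e i) + (g - \sum_i c' i * e i)).
  exact: van_lin.
rewrite scalerBr addrACA -opprD scaler_sumr -big_split; congr (_ - _).
by apply: eq_bigr => i _; rewrite mulrDl scalerAl.
Qed.

Lemma graded_approx : approx n lev e 0.
Proof.
have hln i : (lev i <= n + m)%N by apply: leq_trans (leq_addr _ _).
have h q x : exists c : 'I_r -> R, (forall i, sub (lev i) (c i)) /\ van q (x - \sum_i c i * e i).
  elim: q => [|q [c [hc hx]]].
    by exists (fun=> 0); split=> // i; apply: sub_zero.
  have [c' [hc' hx']] := gspan_split (van_gspan_all hx).
  exists (fun i => c i + c' i); split; first by move=> i; apply: subD.
  rewrite (eq_bigr (fun i => c i * e i + c' i * e i)) => [|i _]; last by rewrite mulrDl.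
  by rewrite big_split opprD addrA.
move=> q x; have [c [hc hx]] := h q x; have [z [w [hz hw ex]]] := van_xpow hx.
by exists c, z, w; split=> //; rewrite -addrA -ex addrC subrK.
Qed.

Theorem graded_span x : exists c : 'I_r -> R,
  (forall i, sub (lev i) (c i)) /\ x = \sum_i c i * e i.
Proof. exact: (tower hS (leq_addr m n) hlev graded_approx). Qed.

End Generators.
End Graded.

(** * Combinatorics of a diagram *)
Lemma mdeg_lt n (a b : 'X_{1..n}) : (a <= b)%MM -> a != b -> (mdeg a < mdeg b)%N.
Proof.
move=> hab hne; rewrite ltn_neqAle mdeg_le // andbT; apply: contra hne => /eqP e.
have /eqP : mdeg (b - a)%MM = 0%N by rewrite mdeg_sub // e subnn.
by rewrite mdeg_eq0 => /eqP e0; rewrite -(submK hab) e0 add0m.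
Qed.

Section Diag.
Variables (n k d : nat) (D : pred 'X_{1..n}) (al : 'I_k -> 'X_{1..n}).
Hypothesis hD : is_diagram D.
Hypothesis hal : lists_vertices D al.
Hypothesis hd : is_ddeg D al d.
Implicit Types a b g w : 'X_{1..n}.

Lemma diagram_up a b : D a -> (a <= b)%MM -> D b.
Proof.
case: hD => s hs; rewrite !hs => /hasP[x xs xa] ab; apply/hasP; exists x => //.
exact: lepm_trans ab.
Qed.

Lemma vertex_diagram i : D (al i).
Proof. by have [h _] := hal; case: (proj2 (h (al i))) => //; exists i. Qed.

(** An element of the diagram that is minimal below [b] is a vertex. *)
Lemma above_vertex b : D b -> exists i, (al i <= b)%MM.
Proof.
have [c] := ubnP (mdeg b); elim: c b => // c IH b hc hb.
case: (pickP (fun a : 'X_{1..n < (mdeg b).+1} => [&& D a, (a <= b)%MM & val a != b])).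
  move=> a /and3P[ha hab hne]; have hm := mdeg_lt hab hne.
  have [|i hi] := IH a _ ha; first by apply: leq_trans hm _; rewrite -ltnS.
  by exists i; apply: lepm_trans hab.
move=> h0; have [hv _] := hal; have [|i <-] := (proj1 (hv b)); last by exists i; apply: lepm_refl.
split=> // a ha hab; have ham : (mdeg a < (mdeg b).+1)%N by rewrite ltnS mdeg_le.
by have := h0 (BMultinom ham); rewrite ha hab => /negbFE/eqP.
Qed.

Lemma vertex_inj i j : al i = al j -> i = j.
Proof.
have irr a : ~~ revlex a a by apply/existsP=> -[t]; rewrite ltnn.
have [_ ho] := hal; move=> e; apply: val_inj; case: (ltngtP i j) => // /ho.
  by rewrite e (negPf (irr _)).
by rewrite e (negPf (irr _)).
Qed.

Lemma vertex_min i j : (al i <= al j)%MM -> i = j.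
Proof.
move=> h; have [hv _] := hal; have [_ hm] : is_vertex D (al j) by apply/hv; exists j.
by apply: vertex_inj; apply: hm => //; apply: vertex_diagram.
Qed.

Lemma inDelta_D i b : inDelta al i b -> D b.
Proof. by case/andP => h _; apply: diagram_up h; apply: vertex_diagram. Qed.

Lemma inDelta_ex b : D b -> exists i, inDelta al i b.
Proof.
move=> /above_vertex[i0 hi0]; have [c] := ubnP (val i0); elim: c i0 hi0 => // c IH i0 hi0 hc.
case: (pickP (fun t : 'I_k => (t < i0)%N && (al t <= b)%MM)) => [t /andP[h1 h2]|h].
  by apply: (IH t) => //; apply: leq_trans h1 _; rewrite -ltnS.
exists i0; rewrite /inDelta hi0; apply/forallP=> t; apply/implyP => ht.
by have := h t; rewrite ht => /negbT.
Qed.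

Lemma inDelta_uniq i j b : inDelta al i b -> inDelta al j b -> i = j.
Proof.
case/andP=> h1 /forallP h2 /andP[h3 /forallP h4]; apply: val_inj.
case: (ltngtP i j) => // h.
  by have := h4 i; rewrite h h1.
by have := h2 j; rewrite h h3.
Qed.

Lemma inDelta_al i : inDelta al i (al i).
Proof.
rewrite /inDelta lepm_refl; apply/forallP=> t; apply/implyP=> ht.
by apply/negP=> /vertex_min e; rewrite e ltnn in ht.
Qed.

(** With coordinates numbered from 0, a vertex of level [l] corresponds to
    [toplev a = l.-1]; the finite part of Gamma_i uses the coordinates below
    [toplev (al i)] and the free directions are the others. *)
Definition toplev a : nat := \max_(t < n | a t != 0%N) t.

Lemma toplev_out a (t : 'I_n) : (toplev a < t)%N -> a t = 0%N.
Proof.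
move=> h; apply/eqP/negPn/negP => ht.
have := @leq_bigmax_cond _ (fun t : 'I_n => a t != 0%N) (fun t : 'I_n => val t) t ht.
by rewrite -/(toplev a) leqNgt h.
Qed.

Lemma toplev_le a l : (forall t : 'I_n, (l < t)%N -> a t = 0%N) -> (toplev a <= l)%N.
Proof.
move=> h; apply/bigmax_leqP => t ht; rewrite leqNgt; apply/negP => /h e.
by rewrite e in ht.
Qed.

Lemma toplev_n a : (toplev a <= n)%N.
Proof. by apply: toplev_le => t; rewrite ltnNge ltnW. Qed.

Lemma toplev_ltn a : (0 < n)%N -> (toplev a < n)%N.
Proof.
move=> hn; suff : (toplev a <= n.-1)%N by lia.
by apply: toplev_le => t ht; have := ltn_ord t; lia.
Qed.

Lemma toplev_level a : level a (toplev a).+1.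
Proof.
split=> // [t ht|l hl hl']; first exact: toplev_out.
by rewrite -(prednK hl) ltnS; apply: toplev_le => t ht; apply: hl'; rewrite -(prednK hl).
Qed.

(** So, at [al i] plus anything, the earlier vertices impose conditions on the first
    [toplev (al i)] coordinates only. *)
Lemma revlex_high (i t : 'I_k) (x : 'I_n) :
  (t < i)%N -> (toplev (al i) <= x)%N -> (al t x <= al i x)%N.
Proof.
have [_ ho] := hal; move=> /ho/existsP[y /andP[h1 /forallP h2]] hx.
have hy : (y <= toplev (al i))%N.
  by rewrite leqNgt; apply/negP => /toplev_out e; rewrite e in h1.
have [->|hxy] := eqVneq x y; first exact: ltnW.
have := h2 x; rewrite (_ : (y < x)%N) => [/eqP -> //|].
by rewrite ltn_neqAle eq_sym hxy (leq_trans hy).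
Qed.

Lemma inDelta_low i g w : inDelta al i (al i + w)%MM ->
  (forall t : 'I_n, (t < toplev (al i))%N -> (g t <= w t)%N) -> inDelta al i (al i + g)%MM.
Proof.
case/andP=> _ /forallP h hg; rewrite /inDelta lem_addr; apply/forallP => t; apply/implyP => ht.
have := h t; rewrite ht /=; apply: contra => /mnm_lepP h1; apply/mnm_lepP => x.
case: (leqP (toplev (al i)) x) => hx.
  by rewrite mnmDE (leq_trans (revlex_high ht hx)) // leq_addr.
by have := h1 x; rewrite !mnmDE; have := hg _ hx; lia.
Qed.

(** Projections, and with them the sets A_j, are decidable because the vertices
    generate the diagram. *)
Definition projb j a := [exists i, [forall t : 'I_n, (t < j)%N ==> (al i t <= a t)%N]].

Lemma projP j a : reflect (in_proj D j a) (projb j a).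
Proof.
apply: (iffP existsP) => [[i /forallP hi]|[b /above_vertex[i /mnm_lepP hi] hb]].
  exists [multinom (if (t < j)%N then a t else al i t) | t < n]; last first.
    by move=> t ht; rewrite mnmE ht.
  apply: (diagram_up (vertex_diagram i)); apply/mnm_lepP => t; rewrite mnmE; case: ifP => // ht.
  by have := hi t; rewrite ht.
by exists i; apply/forallP => t; apply/implyP => ht; rewrite -hb.
Qed.

Lemma proj_le j j' a : (j <= j')%N -> projb j' a -> projb j a.
Proof.
move=> hj /existsP[i /forallP hi]; apply/existsP; exists i; apply/forallP=> t.
by apply/implyP=> ht; have := hi t; rewrite (leq_trans ht hj).
Qed.

Lemma proj_n a : projb n a -> D a.
Proof.
case/existsP=> i /forallP hi; apply: (diagram_up (vertex_diagram i)); apply/mnm_lepP => t.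
by have := hi t; rewrite ltn_ord.
Qed.

Lemma proj_ext j a b : (forall t : 'I_n, (t < j)%N -> a t = b t) -> projb j a = projb j b.
Proof.
move=> h; apply/existsP/existsP => -[i /forallP hi]; exists i; apply/forallP=> t;
  by have := hi t; case: ltnP => //= ht; rewrite h.
Qed.

Definition inA j a :=
  [&& [forall t : 'I_n, (j < t)%N ==> (a t == 0%N)], ~~ projb j.+1 a & projb j a].

Lemma inAP j a : reflect (setA D j.+1 a) (inA j a).
Proof.
apply: (iffP and3P) => [[/forallP h1 /projP h2 /projP h3]|[h1 h2 h3]].
  by split=> // t ht; have := h1 t; rewrite ht => /eqP.
split; [|exact/projP|exact/projP].
by apply/forallP=> t; apply/implyP=> ht; apply/eqP/h1.
Qed.

Lemma inA_uniq j j' a : inA j a -> inA j' a -> j = j'.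
Proof.
move=> /and3P[_ h1 h2] /and3P[_ h3 h4]; case: (ltngtP j j') => // h.
  by case/negP: h1; apply: proj_le h4.
by case/negP: h3; apply: proj_le h2.
Qed.

Lemma inA_deg (j : 'I_n) a : inA j a -> (mdeg a <= d)%N.
Proof. by move/inAP=> h; apply: (proj1 hd); exists j.+1; [rewrite ltn_ord|left]. Qed.

(** Gamma is the union of the A_j x N^(n-j): take for j + 1 the least length of a
    prefix of [a] that is not in the projection of the diagram. *)
Lemma gamma_dec a : (0 < k)%N -> ~~ D a -> exists (j : 'I_n) b w,
  [/\ inA j b, forall t : 'I_n, (t <= j)%N -> w t = 0%N & a = (w + b)%MM].
Proof.
move=> hk ha.
have p0 : projb 0 a by apply/existsP; exists (Ordinal hk); apply/forallP.
have pn : exists j, ~~ projb j a by exists n; apply: contra ha; apply: proj_n.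
case: (ex_minnP pn) => -[|j] hj hm; first by rewrite p0 in hj.
have hj' : projb j a by apply: contraT => /hm; rewrite ltnn.
have hjn : (j < n)%N.
  by apply: hm; apply: contra ha; apply: proj_n.
pose b := [multinom (if (t <= j)%N then a t else 0%N) | t < n].
pose w := [multinom (if (t <= j)%N then 0%N else a t) | t < n].
exists (Ordinal hjn), b, w; split => /=.
- apply/and3P; split; first by apply/forallP=> t; apply/implyP=> ht; rewrite mnmE leqNgt ht.
    by rewrite (@proj_ext _ b a) // => t ht; rewrite mnmE -ltnS ht.
  by rewrite (@proj_ext _ b a) // => t ht; rewrite mnmE ltnW.
- by move=> t ht; rewrite mnmE ht.
by apply/mnmP=> t; rewrite mnmDE !mnmE; case: ifP => _; rewrite ?addn0.
Qed.

Definition inB i g :=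
  [forall t : 'I_n, (toplev (al i) <= t)%N ==> (g t == 0%N)] &&
  inDelta al i (al i + g)%MM.

Lemma inB_deg i g : inB i g -> (mdeg (al i + g)%MM <= d)%N.
Proof.
case/andP=> /forallP h1 h2; case: (posnP n) => hn.
  suff -> : mdeg (al i + g)%MM = 0%N by [].
  by rewrite mdegE big1 // => t; have := ltn_ord t; rewrite {2}hn.
apply: (proj1 hd); exists (toplev (al i)).+1; first exact: toplev_ltn.
right; exists i, g; split=> //; first exact: toplev_level.
by move=> t ht; have := h1 t; rewrite ht => /eqP.
Qed.

(** Delta_i is al_i plus a finite subset of N^(l-1), l the level of al_i, plus the
    orthant N^(n-l+1) of the other coordinates. *)
Lemma delta_dec i b : inDelta al i b -> exists g w,
  [/\ inB i g, forall t : 'I_n, (t < toplev (al i))%N -> w t = 0%N & (b - al i)%MM = (w + g)%MM].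
Proof.
move=> hb; have hle : (al i <= b)%MM by case/andP: hb.
pose h := (b - al i)%MM.
pose g := [multinom (if (t < toplev (al i))%N then h t else 0%N) | t < n].
pose w := [multinom (if (t < toplev (al i))%N then 0%N else h t) | t < n].
exists g, w; split.
- apply/andP; split; first by apply/forallP=> t; apply/implyP=> ht; rewrite mnmE ltnNge ht.
  apply: (@inDelta_low _ _ h); first by rewrite submKC.
  by move=> t ht; rewrite mnmE ht.
- by move=> t ht; rewrite mnmE ht.
by apply/mnmP=> t; rewrite mnmDE !mnmE -mnmBE; case: ifP => _; rewrite ?addn0.
Qed.

End Diag.

(** * The division theorem *)
Lemma sum_neq0 (V : zmodType) (T : finType) (P : pred T) (F : T -> V) :
  \sum_(i | P i) F i <> 0 -> exists2 i, P i & F i <> 0.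
Proof.
move=> hne; case: (pickP (fun i => P i && (F i != 0))) => [i /andP[h1 /eqP h2]|h0].
  by exists i.
by case: hne; apply: big1 => i hi; have := h0 i; rewrite hi => /negbFE/eqP.
Qed.

Lemma hasse_sub K (S : smooth_data K) (hS : smooth_category S) N l (h : S N) (c : 'X_{1..N})
    (i : 'I_N) : (l <= N)%N -> sub l h -> (i < l)%N -> hasse c h <> 0 -> c i = 0%N.
Proof.
move=> hl hsub hi hne; apply/eqP/negPn/negP; rewrite -lt0n => hc.
have e : (N - l + l)%N = N by rewrite subnK.
case: hne; apply: (hasse_out hS (@tail_inj N _ _ e)) hc; first exact/(subP hS).
exact: tail_out.
Qed.

Section Division.
Variables (K : fieldType) (S : smooth_data K).
Hypothesis hS : smooth_category S.
Variables n m k d : nat.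
Variables (D : pred 'X_{1..n}) (al : 'I_k -> 'X_{1..n}).
Hypothesis hD : is_diagram D.
Hypothesis hal : lists_vertices D al.
Hypothesis hd : is_ddeg D al d.
Local Notation R := (S (n + m)%N).
Variable f : 'I_k -> R.
Hypothesis hf : forall i, van (mdeg (al i)) (f i).
Hypothesis hJ : forall s, (s <= d.+1)%N -> genJ D al f s \is a GRing.unit.
Hypothesis hk : (0 < k)%N.
Local Notation cu := (mnm_pull (lshift m : 'I_n -> 'I_(n + m))).
Local Notation pu := (mnm_push (lshift m : 'I_n -> 'I_(n + m))).

Definition jac0 (a b : 'X_{1..n}) : K := at0 (jac_entry al f a b).

Lemma jac0E i a b : inDelta al i b ->
  jac0 a b = if (b <= a + al i)%MM then uco (f i) (a + al i - b)%MM else 0.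
Proof.
move=> hb; rewrite /jac0 /jac_entry; case: pickP => [j hj|/(_ i)]; last by rewrite hb.
rewrite (inDelta_uniq hj hb); case: ifP => _; last exact: at0_0.
by rewrite /hasse_u -(taylorE hS).
Qed.

Lemma at0_jac s (A : {set 'X_{1..n < s.+1}}) :
  at0 (jac al f A) = \det (\matrix_(p < #|A|, q < #|A|) jac0 (enum_val p) (enum_val q)).
Proof.
rewrite -[at0 _]/(at0r hS _) -det_map_mx; congr (\det _).
by apply/matrixP=> p q; rewrite !mxE.
Qed.

(** The column [b] of the Jacobian matrix at the origin consists of the
    coefficients of u^(b - al_i) f_i, i being the index with [b] in Delta_i. *)
Lemma jac0_uco i a b : inDelta al i b -> uco (umon S m (b - al i)%MM * f i) a = jac0 a b.
Proof.
move=> hb; have hle : (al i <= b)%MM by case/andP: hb.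
rewrite (jac0E _ hb) (uco_umonM hS).
have -> : ((b - al i <= a) = (b <= a + al i))%MM.
  by apply/mnm_lepP/mnm_lepP => h t; move: (h t); rewrite mnmBE mnmDE leq_subLR addnC.
by case: ifP => // h; rewrite submBA.
Qed.

(** The generators: [inl (i, g)] stands for u^g f_i with [g] in the finite part of
    Gamma_i, and [inr (j, a)] for u^a with [a] in A_(j+1). The degree bound [d] makes
    the type finite; indices outside these sets stand for 0. *)
Definition gens : finType := (('I_k * 'X_{1..n < d.+1}) + ('I_n * 'X_{1..n < d.+1}))%type.

Definition gen_lev (x : gens) : nat :=
  match x with inl (i, g) => toplev (al i) | inr (j, a) => j.+1 end.

Definition gen_deg (x : gens) : nat :=
  match x with
  | inl (i, g) => if inB al i g then mdeg (al i + g)%MM else 0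
  | inr (j, a) => mdeg a
  end.

Definition gen_val (x : gens) : R :=
  match x with
  | inl (i, g) => if inB al i g then umon S m g * f i else 0
  | inr (j, a) => if inA al j a then umon S m a else 0
  end.

Let r := #|{: gens}|.
Let lev (x : 'I_r) := gen_lev (enum_val x).
Let deg (x : 'I_r) := gen_deg (enum_val x).
Let e (x : 'I_r) := gen_val (enum_val x).

Let hlev x : (lev x <= n)%N.
Proof.
by rewrite /lev; case: (enum_val x) => [[i g]|[j a]] /=; [exact: toplev_n|exact: ltn_ord].
Qed.

Let hdeg x : (deg x <= d)%N.
Proof.
rewrite /deg; case: (enum_val x) => [[i g]|[j a]] /=; last by have := bmdeg a; rewrite ltnS.
by case: ifP => // /(inB_deg hd).
Qed.

Let he x : van (deg x) (e x).
Proof.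
rewrite /deg /e; case: (enum_val x) => [[i g]|[j a]] /=; case: ifP => _.
- by rewrite mdegD addnC; apply: (van_mul hS) => //; apply: (van_umon hS).
- by move=> ? _; apply: taylor0.
- exact: (van_umon hS).
- by move=> ? _; apply: taylor0.
Qed.

Local Notation inspan := (gspan lev deg e).

Let span_gen (x : gens) (w : 'X_{1..n}) : (forall t : 'I_n, (t < gen_lev x)%N -> w t = 0%N) ->
  inspan (mdeg w + gen_deg x)%N (umon S m w * gen_val x).
Proof.
have := @gspan_gen _ S n m r lev deg e (mdeg w + gen_deg x)%N (enum_rank x) w.
by rewrite /lev /deg /e enum_rankK => h hw; apply: h.
Qed.

Let span_gamma a : ~~ D a -> inspan (mdeg a) (umon S m a).
Proof.
move=> ha; have [j [b [w [hb hw ea]]]] := gamma_dec hD hal hk ha.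
have hbd : (mdeg b < d.+1)%N by rewrite ltnS (inA_deg hD hal hd hb).
have := @span_gen (inr (j, BMultinom hbd)) w hw.
by rewrite /= hb -mdegD -(umonD S m) -ea.
Qed.

Let span_delta i b : inDelta al i b -> inspan (mdeg b) (umon S m (b - al i)%MM * f i).
Proof.
move=> hb; have [g [w [hg hw ebg]]] := delta_dec hal hb.
have hle : (al i <= b)%MM by case/andP: hb.
have hgd : (mdeg g < d.+1)%N.
  by rewrite ltnS; apply: leq_trans (inB_deg hd hg); rewrite mdegD leq_addl.
have := @span_gen (inl (i, BMultinom hgd)) w hw.
rewrite /= hg mulrA -(umonD S m) ebg -{1}(submK hle) ebg.
by rewrite !mdegD addnAC addnA addnC.
Qed.

(** By invertibility of the matrix of J^q, the monomials of degree q in Delta are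
    combinations, modulo Gamma, of the leading forms of the u^(b - al_i) f_i. *)
Let span_base q a : (q <= d.+1)%N -> mdeg a = q -> inspan q (umon S m a).
Proof.
move=> hq ha; case: (boolP (D a)) => hDa; last by rewrite -ha; apply: span_gamma.
pose A := Dset D q.
pose ev (p : 'I_#|A|) : 'X_{1..n < q.+1} := enum_val p.
pose M : 'M[K]_#|A| := \matrix_(p < #|A|, p' < #|A|) jac0 (ev p) (ev p').
have hM : M \in unitmx.
  by rewrite unitmxE unitfE -at0_jac -(unit_at0 hS); apply: hJ.
have hA (p : 'I_#|A|) : D (ev p) /\ mdeg (ev p) = q.
  by have := enum_valP p; rewrite -/(ev p) inE => /andP[h /eqP].
have col p' : inspan q (\sum_p M p p' *: umon S m (ev p)).
  have [hDb hmb] := hA p'; have [i hi] := inDelta_ex hal hDb.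
  set F := umon S m (ev p' - al i)%MM * f i.
  have gF : inspan q F by rewrite -hmb; apply: span_delta.
  have eM : \sum_p M p p' *: umon S m (ev p) =
      \sum_(b : 'X_{1..n < q.+1} | (mdeg b == q) && D b) uco F b *: umon S m b.
    transitivity (\sum_(b in A) uco F b *: umon S m b); last first.
      by apply: eq_bigl => b; rewrite inE andbC.
    rewrite [RHS]big_enum_val; apply: eq_bigr => p _.
    by rewrite mxE -(jac0_uco _ hi).
  have -> : \sum_p M p p' *: umon S m (ev p) =
      F - ((F - \sum_(b : 'X_{1..n < q.+1} | mdeg b == q) uco F b *: umon S m b)
       + \sum_(b : 'X_{1..n < q.+1} | (mdeg b == q) && ~~ D b) uco F b *: umon S m b).
    rewrite eM [\sum_(b : 'X_{1..n < q.+1} | mdeg b == q) _](bigID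
      (fun b : 'X_{1..n < q.+1} => D b)) /=.
    by ring.
  apply: gspanD => //; rewrite -scaleN1r; apply: gspanZ => //; apply: gspanD => //.
    apply: gspan_high; apply: (van_rem hS).
    have hle : (al i <= ev p')%MM by case/andP: hi.
    by rewrite -hmb -{1}(submK hle) mdegD; apply: (van_mul hS) => //; apply: (van_umon hS).
  apply: gspan_sum => // b /andP[/eqP hb hDb']; apply: gspanZ => //.
  by have := span_gamma hDb'; rewrite hb.
have haq : (mdeg a < q.+1)%N by rewrite ha.
have hain : BMultinom haq \in A by rewrite inE hDa ha eqxx.
pose p0 := enum_rank_in hain (BMultinom haq).
have -> : umon S m a = \sum_p' invmx M p' p0 *: \sum_p M p p' *: umon S m (ev p).
  rewrite (eq_bigr (fun p' => \sum_p (M p p' * invmx M p' p0) *: umon S m (ev p))); last first.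
    by move=> p' _; rewrite scaler_sumr; apply: eq_bigr => p _; rewrite scalerA mulrC.
  rewrite exchange_big (bigD1 p0) //= [\sum_(i | i != p0) _]big1 ?addr0 => [|p hp].
    rewrite -scaler_suml (_ : \sum_i _ = (M *m invmx M) p0 p0); last by rewrite mxE.
    by rewrite mulmxV // mxE eqxx scale1r /ev enum_rankK_in.
  rewrite -scaler_suml (_ : \sum_i _ = (M *m invmx M) p p0); last by rewrite mxE.
  by rewrite mulmxV // mxE (negPf hp) scale0r.
by apply: gspan_sum => // p' _; apply: gspanZ.
Qed.

(** Differentiating [h] in a direction below [l] gives 0, so only the monomial can
    absorb those components of [b]. *)
Let supp_low l (g : 'X_{1..n}) (h : R) b : (l <= n)%N -> sub l h -> hasse b (h * umon S m g) <> 0 ->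
    forall t : 'I_n, (t < l)%N -> (cu b t <= g t)%N.
Proof.
move=> hl hh; rewrite (hasse_mul hS) => /sum_neq0[a hab hne] t ht.
have ha : hasse a h <> 0 by move=> e0; apply: hne; rewrite e0 mul0r.
have hg : (b - a <= pu g)%MM.
  by apply: contraT => /(hasse_mon0 hS) e0; case: hne; rewrite umonE e0 mulr0.
have a0 : a (lshift m t) = 0%N.
  by apply: (hasse_sub hS _ hh _ ha) => //; apply: leq_trans hl _; apply: leq_addr.
have /mnm_lepP/(_ (lshift m t)) := hg.
rewrite mnmBE a0 subn0 mnm_push_in; last exact: lshift_inj.
by rewrite [cu b t]mnmE.
Qed.

(** The supports are described by nonvanishing derivatives in R, which is stronger
    than nonvanishing Taylor coefficients. *)
Theorem division x : exists (q : 'I_k -> R) (rmd : R),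
  [/\ x = \sum_i q i * f i + rmd,
      forall i c, hasse c (q i) <> 0 -> inDelta al i (al i + cu c)%MM,
      normal_form D rmd
    & forall c, hasse c rmd <> 0 -> ~~ D (cu c)].
Proof.
have [c [hc ex]] := graded_span hS hlev hdeg he span_base x.
pose cc (y : gens) := c (enum_rank y).
have hcc y : sub (gen_lev y) (cc y) by have := hc (enum_rank y); rewrite /lev enum_rankK.
exists (fun i => \sum_(g : 'X_{1..n < d.+1} | inB al i g) cc (inl (i, g)) * umon S m g).
exists (\sum_(j < n) \sum_(a : 'X_{1..n < d.+1} | inA al j a) cc (inr (j, a)) * umon S m a).
split.
- rewrite ex (reindex (enum_rank : gens -> 'I_r)) /=; last exact: onW_bij (enum_rank_bij _).
  rewrite (eq_bigr (fun y => cc y * gen_val y)) => [|y _]; last by rewrite /e enum_rankK.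
  rewrite big_sumType /=; congr (_ + _).
    rewrite (eq_bigr (fun p => cc (inl (p.1, p.2)) * gen_val (inl (p.1, p.2)))); last by case.
    rewrite -(pair_bigA _ (fun i g => cc (inl (i, g)) * gen_val (inl (i, g)))) /=.
    apply: eq_bigr => i _; rewrite mulr_suml [RHS]big_mkcond; apply: eq_bigr => g _.
    by case: ifP => _; rewrite ?mulr0 // mulrA.
  rewrite (eq_bigr (fun p => cc (inr (p.1, p.2)) * gen_val (inr (p.1, p.2)))); last by case.
  rewrite -(pair_bigA _ (fun i g => cc (inr (i, g)) * gen_val (inr (i, g)))) /=.
  apply: eq_bigr => i _; rewrite [RHS]big_mkcond; apply: eq_bigr => g _.
  by case: ifP => _; rewrite ?mulr0.
- move=> i b; rewrite hasse_sum // => /sum_neq0[g hg hne].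
  have hle := supp_low (toplev_n _) (hcc (inl (i, g))) hne.
  by case/andP: hg => _ hg; apply: (inDelta_low hal hg hle).
- exists (fun j => [seq val a | a <- enum {: 'X_{1..n < d.+1}} & inA al j (val a)]).
  exists (fun a => if [pick j : 'I_n | inA al j a] is Some j then
     if insub a is Some a' then cc (inr (j, a')) else 0 else 0).
  have hpick (j : 'I_n) a : inA al j a -> [pick j : 'I_n | inA al j a] = Some j.
    move=> hj; case: pickP => [j' hj'|/(_ j)]; last by rewrite hj.
    by congr Some; apply: val_inj; apply: inA_uniq hj' hj.
  have hmem (j : 'I_n) a : a \in [seq val a | a <- enum {: 'X_{1..n < d.+1}} & inA al j (val a)]
      -> inA al j a.
    by case/mapP => a'; rewrite mem_filter => /andP[h _] ->.
  split.
  + move=> j; split.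
      by rewrite map_inj_uniq; [rewrite filter_uniq // enum_uniq|exact: val_inj].
    move=> a; split; first by move/hmem/(inAP hD hal).
    move/(inAP hD hal) => h.
    have had : (mdeg a < d.+1)%N by rewrite ltnS (inA_deg hD hal hd h).
    by apply/mapP; exists (BMultinom had) => //; rewrite mem_filter /= h mem_enum.
  + move=> j a /hmem hj; rewrite (hpick _ _ hj).
    apply/(@sub_fun_of _ _ hS _ _ j.+1); first by move=> x1 x2 /(congr1 val) /= /addIn/val_inj.
      move=> i; split=> [hi|[l ->]]; last exact: leq_addl.
      have hil : (i - j.+1 < n + m - j.+1)%N by have := ltn_ord i; lia.
      by exists (Ordinal hil); apply: val_inj; rewrite /= subnK.
    case: insub => [a'|]; first exact: (hcc (inr (j, a'))).
    by apply: (sub_zero hS); apply: leq_trans (ltn_ord j) (leq_addr _ _).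
  + apply: eq_bigr => j _; rewrite big_map big_filter big_enum_cond /=.
    by apply: eq_bigr => a ha; rewrite (hpick _ _ ha) valK.
move=> b; rewrite hasse_sum // => /sum_neq0[j _]; rewrite hasse_sum // => /sum_neq0[a ha hne].
have hle := supp_low (ltn_ord j) (hcc (inr (j, a))) hne.
apply/negP => /(above_vertex hal)[i /mnm_lepP hi]; case/and3P: ha => _ /negP h _; apply: h.
apply/existsP; exists i; apply/forallP => t; apply/implyP => ht.
by apply: leq_trans (hi t) (hle t ht).
Qed.

End Division.

(** * Orders and uniqueness of the division *)
Section Orders.
Variables (K : fieldType) (S : smooth_data K).
Hypothesis hS : smooth_category S.

Lemma is_ordE n (F : S n) s : is_ord F s -> forall a, (mdeg a < s)%N -> taylor F a = 0.
Proof.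
case=> _ hmin a ha; apply/eqP; apply: contraT => hne.
have : (s <= mdeg a)%N; last by rewrite leqNgt ha.
apply: hmin => j /(taylor_pow hS) hj; rewrite leqNgt; apply/negP => /hj e.
by rewrite e eqxx in hne.
Qed.

Lemma is_ordI n (F : S n) s a : (forall b, (mdeg b < s)%N -> taylor F b = 0) ->
  mdeg a = s -> taylor F a != 0 -> is_ord F s.
Proof.
move=> h0 ha hne; split=> [j|b hb]; last by apply: hb; apply/(taylor_pow hS).
move/(taylor_pow hS) => hj; rewrite leqNgt -ha; apply/negP => /hj e.
by rewrite e eqxx in hne.
Qed.

End Orders.

Section Weights.
Variables (K : fieldType) (S : smooth_data K).
Hypothesis hS : smooth_category S.
Variables n m : nat.
Local Notation R := (S (n + m)%N).
Local Notation cu := (mnm_pull (lshift m : 'I_n -> 'I_(n + m))).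
Local Notation pu := (mnm_push (lshift m : 'I_n -> 'I_(n + m))).
Local Notation cv := (mnm_pull (@rshift n m)).
Local Notation pv := (mnm_push (@rshift n m)).
Local Notation linj := (@lshift_inj n m).
Local Notation rinj := (@rshift_inj n m).
Implicit Types (c : 'X_{1..n + m}) (w s : nat).

Lemma ord_uv (P : 'I_(n + m) -> Prop) : (forall i, P (lshift m i)) -> (forall j, P (rshift n j)) ->
  forall x, P x.
Proof.
move=> hl hr x; case: (splitP x) => j hj.
  by have -> : x = lshift m j by apply: val_inj.
by have -> : x = rshift n j by apply: val_inj.
Qed.

Lemma pu_r (a : 'X_{1..n}) j : pu a (rshift n j) = 0%N.
Proof. by rewrite mnm_push_out // => l; rewrite eq_lrshift. Qed.

Lemma pv_l (a : 'X_{1..m}) j : pv a (lshift m j) = 0%N.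
Proof. by rewrite mnm_push_out // => l; rewrite eq_rlshift. Qed.

Lemma uvK c : (pu (cu c) + pv (cv c))%MM = c.
Proof.
apply/mnmP; apply: ord_uv => i; rewrite mnmDE.
  by rewrite pv_l addn0 (mnm_push_in linj) mnmE.
by rewrite pu_r add0n (mnm_push_in rinj) mnmE.
Qed.

Lemma cu_uv (a : 'X_{1..n}) (y : 'X_{1..m}) : cu (pu a + pv y)%MM = a.
Proof. by apply/mnmP=> i; rewrite mnmE mnmDE pv_l addn0 (mnm_push_in linj). Qed.

Lemma cv_uv (a : 'X_{1..n}) (y : 'X_{1..m}) : cv (pu a + pv y)%MM = y.
Proof. by apply/mnmP=> i; rewrite mnmE mnmDE pu_r add0n (mnm_push_in rinj). Qed.

(** The degree for which the v_j have weight [w]; [w = 1] gives the order in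
    (u, v) and a large [w] the order of the restriction to v = 0. *)
Definition wdeg w c : nat := (mdeg (cu c) + w * mdeg (cv c))%N.

Lemma pullD p (s : 'I_p -> 'I_(n + m)) c c' :
  mnm_pull s (c + c')%MM = (mnm_pull s c + mnm_pull s c')%MM.
Proof. by apply/mnmP=> i; rewrite mnmDE !mnmE. Qed.

Lemma wdegD w c c' : wdeg w (c + c')%MM = (wdeg w c + wdeg w c')%N.
Proof. by rewrite /wdeg !pullD !mdegD; lia. Qed.

Lemma wdeg_uv w (a : 'X_{1..n}) (y : 'X_{1..m}) : wdeg w (pu a + pv y)%MM = (mdeg a + w * mdeg y)%N.
Proof. by rewrite /wdeg cu_uv cv_uv. Qed.

Lemma wdeg_pu w (a : 'X_{1..n}) : wdeg w (pu a) = mdeg a.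
Proof. by rewrite -[pu a]addm0 -(mnm_push0 (@rshift n m)) wdeg_uv mdeg0 muln0 addn0. Qed.

Lemma wdeg1 c : wdeg 1 c = mdeg c.
Proof. by rewrite -{2}(uvK c) mdegD !mdeg_push /wdeg mul1n. Qed.

Definition wvan w s (F : R) : Prop := forall c, (wdeg w c < s)%N -> taylor F c = 0.

Lemma wvan_mul w s s' F G : wvan w s F -> wvan w s' G -> wvan w (s + s') (F * G).
Proof.
move=> hF hG c hc; rewrite (taylor_mul hS) big1 // => b hb.
have := wdegD w (c - b)%MM b; rewrite submK // => e.
case: (ltnP (wdeg w b) s) => h; first by rewrite hF ?mul0r.
by rewrite hG ?mulr0 //; lia.
Qed.

Lemma wvanW w s s' F : (s <= s')%N -> wvan w s' F -> wvan w s F.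
Proof. by move=> h hF c hc; apply: hF; apply: leq_trans h. Qed.

Lemma wvan_sum w s (T : finType) (P : pred T) (F : T -> R) :
  (forall i, P i -> wvan w s (F i)) -> wvan w s (\sum_(i | P i) F i).
Proof. by move=> h c hc; rewrite (taylor_sum hS) big1 // => i hi; apply: h. Qed.

Lemma wvan_umon w (a : 'X_{1..n}) : wvan w (mdeg a) (umon S m a).
Proof.
move=> c hc; rewrite umonE (taylor_mon hS); case: eqP => // e.
by move: hc; rewrite -e wdeg_pu ltnn.
Qed.

Section Unique.
Variables (k d : nat) (D : pred 'X_{1..n}) (al : 'I_k -> 'X_{1..n}) (f : 'I_k -> R).
Hypothesis hD : is_diagram D.
Hypothesis hal : lists_vertices D al.
Hypothesis hJ : forall s, (s <= d.+1)%N -> genJ D al f s \is a GRing.unit.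
Variable w : nat.
Hypothesis hfw : forall i, wvan w (mdeg (al i)) (f i).
Variable q : 'I_k -> R.
Hypothesis hq : forall i c, taylor (q i) c != 0 -> inDelta al i (al i + cu c)%MM.

(** Each [b] in Delta lies in a single Delta_j, so that this sum has one term: the
    coefficients of v^y in all the q_j are arranged into one vector indexed by
    Delta. *)
Definition qvec (y : 'X_{1..m}) (b : 'X_{1..n}) : K :=
  \sum_(j | inDelta al j b) taylor (q j) (pu (b - al j) + pv y)%MM.

Lemma qvec1 y j b : inDelta al j b -> qvec y b = taylor (q j) (pu (b - al j) + pv y)%MM.
Proof.
move=> hj; rewrite /qvec (bigD1 j) //= big1 ?addr0 // => i /andP[hi hij].
by rewrite (inDelta_uniq hi hj) eqxx in hij.
Qed.

(** The generalized Jacobian governs the lowest terms of a combination of the f_j.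
    For the weighted degree, if q_j has order at least s' - |al_j| and in that
    lowest degree only v-exponents of degree at least |y|, then the coefficient of
    u^a v^y in sum_j q_j f_j only sees the terms with v-exponent [y] of the q_j and
    those of degree |al_j| without v of the f_j. *)
Lemma lowest_coef s' y t a :
  (forall j c, (wdeg w c + mdeg (al j) < s')%N -> taylor (q j) c = 0) ->
  (forall j c, (wdeg w c + mdeg (al j) = s')%N -> (mdeg (cv c) < mdeg y)%N -> taylor (q j) c = 0) ->
  (t + w * mdeg y = s')%N -> mdeg a = t ->
  taylor (\sum_j q j * f j) (pu a + pv y)%MM = \sum_(b in Dset D t) jac0 al f a b * qvec y b.
Proof.
move=> H1 H2 ht ha; set C := (pu a + pv y)%MM.
(* the terms of q_j that contribute *)
pose P j : R := \sum_(b : 'X_{1..n < t.+1} | (mdeg b == t) && inDelta al j b)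
  taylor (q j) (pu (b - al j) + pv y)%MM *: mon S (pu (b - al j) + pv y)%MM.
have hP j c : (c <= C)%MM -> (mdeg (al j) <= wdeg w (C - c)%MM)%N -> taylor (q j - P j) c = 0.
  move=> hcC hw.
  have es' : (wdeg w c + wdeg w (C - c)%MM)%N = s'.
    by rewrite -wdegD submKC // wdeg_uv ha.
  have hy : (cv c <= y)%MM.
    apply/mnm_lepP=> i; move/mnm_lepP: hcC => /(_ (rshift n i)).
    by rewrite mnmDE pu_r (mnm_push_in rinj) mnmE.
  have Pc : taylor (P j) c = \sum_(b : 'X_{1..n < t.+1} | (mdeg b == t) && inDelta al j b)
      taylor (q j) c * ((pu (b - al j) + pv y)%MM == c)%:R.
    rewrite (taylor_sum hS); apply: eq_bigr => b _; rewrite (taylorZ hS) (taylor_mon hS).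
    by case: eqP => [->|_]; rewrite ?mulr0.
  rewrite (taylorB hS) Pc.
  have [-> |hne] := eqVneq (taylor (q j) c) 0.
    by rewrite big1 ?subr0 // => b _; rewrite mul0r.
  have hin := hq hne.
  have hs' : (wdeg w c + mdeg (al j))%N = s'.
    apply/eqP; rewrite eqn_leq; apply/andP; split; first by rewrite -es' leq_add2l.
    by rewrite leqNgt; apply: contra hne => /H1 ->.
  have ey : cv c = y.
    by apply/eqP; apply: contraNT hne => hne'; apply/eqP; apply: H2 => //; apply: mdeg_lt.
  have hb : mdeg (al j + cu c)%MM = t.
    by move: hs'; rewrite /wdeg ey mdegD -ht; lia.
  have hbt : (mdeg (al j + cu c)%MM < t.+1)%N by rewrite hb.
  rewrite (bigD1 (BMultinom hbt)) /=; last by rewrite hb eqxx.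
  have -> : (al j + cu c - al j)%MM = cu c by rewrite addmC addmK.
  have -> : (pu (cu c) + pv y)%MM = c by rewrite -ey uvK.
  rewrite eqxx mulr1 big1 ?addr0 ?subrr // => b /andP[/andP[_ hjb] hne'].
  case: eqP => [e|_]; last by rewrite mulr0.
  case/eqP: hne'; apply: val_inj => /=; rewrite -e cu_uv submKC //.
  by case/andP: hjb.
rewrite (eq_bigr (fun j => (q j - P j) * f j + P j * f j)) => [|j _]; last by rewrite -mulrDl subrK.
rewrite big_split (taylor_add hS) [X in X + _](_ : _ = 0) ?add0r; last first.
  rewrite (taylor_sum hS) big1 // => j _; rewrite (taylor_mul hS) big1 // => c hc.
  case: (leqP (mdeg (al j)) (wdeg w (C - c)%MM)) => hw; first by rewrite hP ?mul0r.
  by rewrite hfw ?mulr0.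
rewrite (taylor_sum hS).
rewrite (eq_bigr (fun j => \sum_(b : 'X_{1..n < t.+1} | (mdeg b == t) && inDelta al j b)
   taylor (q j) (pu (b - al j) + pv y)%MM * jac0 al f a b)); last first.
  move=> j _; rewrite mulr_suml (taylor_sum hS); apply: eq_bigr => b /andP[_ hjb].
  rewrite -scalerAl (taylorZ hS); congr (_ * _).
  rewrite addmC monD -mulrA (taylor_monM hS) lem_addl -umonE /C addmK.
  exact: jac0_uco.
rewrite (exchange_big_dep (fun b : 'X_{1..n < t.+1} => mdeg b == t)) /=; last first.
  by move=> j b _ /andP[].
rewrite [RHS]big_mkcond [LHS]big_mkcond; apply: eq_bigr => b _; rewrite inE.
case: eqP => hb; last by rewrite andbF.
rewrite andbT mulrC; case: ifP => hDb.
  by rewrite /qvec mulr_suml; apply: eq_bigl => j.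
rewrite big1 // => j /andP[_ /(inDelta_D hD hal)]; by rewrite hDb.
Qed.

Lemma jac_inj s (A : {set 'X_{1..n < s.+1}}) (X : 'X_{1..n} -> K) : jac al f A \is a GRing.unit ->
  (forall a : 'X_{1..n < s.+1}, a \in A -> \sum_(b in A) jac0 al f a b * X b = 0) ->
  forall b : 'X_{1..n < s.+1}, b \in A -> X b = 0.
Proof.
rewrite (unit_at0 hS) (at0_jac hS) => hdet hX b hb.
pose ev (p : 'I_#|A|) : 'X_{1..n < s.+1} := enum_val p.
set M := (\matrix_(p < #|A|, q < #|A|) _) in hdet.
pose x : 'cV[K]_#|A| := \col_p X (ev p).
have hM : M \in unitmx by rewrite unitmxE unitfE.
have : M *m x = 0.
  apply/colP=> p; rewrite !mxE -[RHS](hX (ev p) (enum_valP p)).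
  by rewrite [RHS]big_enum_val; apply: eq_bigr => p' _; rewrite !mxE.
move/(congr1 (mulmx (invmx M))); rewrite mulKmx // mulmx0 => /colP/(_ (enum_rank_in hb b)).
by rewrite !mxE /ev enum_rankK_in.
Qed.

(** Induction on the weighted degree, then on the degree in v: by [lowest_coef] the
    lowest coefficients are in the kernel of an invertible matrix. *)
Lemma division_unique s rmd : (s <= d.+2)%N ->
  (forall c, taylor rmd c != 0 -> ~~ D (cu c)) ->
  wvan w s (\sum_j q j * f j + rmd) ->
  forall j c, (wdeg w c + mdeg (al j) < s)%N -> taylor (q j) c = 0.
Proof.
move=> hs hrr hsum.
suff main s' : (s' <= s)%N -> forall j c, (wdeg w c + mdeg (al j) < s')%N -> taylor (q j) c = 0.
  exact: main.
elim: s' => // s' IH hs' j c; rewrite ltnS leq_eqVlt => /orP[/eqP|]; last by apply: IH; apply: ltnW.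
have [y] := ubnP (mdeg (cv c)); elim: y j c => // y IHy j c hy ec.
apply/eqP; apply: contraT => hne; have hin := hq hne.
pose t := mdeg (al j + cu c)%MM.
have ht : (t + w * mdeg (cv c) = s')%N by rewrite -ec /t mdegD /wdeg; lia.
have htd : (mdeg (al j + cu c)%MM < t.+1)%N by [].
have hX : qvec (cv c) (BMultinom htd) = 0.
  apply: (jac_inj (A := Dset D t)); last by rewrite inE (inDelta_D hD hal hin) /= eqxx.
    by apply: hJ; lia.
  move=> a; rewrite inE => /andP[hDa /eqP hat].
  rewrite -(lowest_coef (s' := s') _ _ ht hat); last first.
  - by move=> j' c' ec' hc'; apply: IHy => //; apply: leq_trans hc' _; rewrite -ltnS.
  - by apply: IH; apply: ltnW.
  have := hsum (pu a + pv (cv c))%MM; rewrite wdeg_uv hat ht => /(_ hs').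
  rewrite (taylor_add hS) [X in _ + X](_ : _ = 0) ?addr0 //.
  by apply/eqP; apply: contraT => /hrr; rewrite cu_uv hDa.
move: hX; rewrite (qvec1 _ hin) /= [(al j + _)%MM]addmC addmK uvK => e.
by rewrite e eqxx in hne.
Qed.

End Unique.
End Weights.

(** * The new generators *)
Section Generation.
Variable R : comUnitRingType.

Lemma ideal_gen_unitmx k (Q : 'M[R]_k) (f fb : 'I_k -> R) : Q \in unitmx ->
  (forall i, fb i = \sum_j Q i j * f j) -> forall g, ideal_gen fb g <-> ideal_gen f g.
Proof.
have half (P : 'M[R]_k) (x y : 'I_k -> R) : (forall i, y i = \sum_j P i j * x j) ->
    forall g, ideal_gen y g -> ideal_gen x g.
  move=> hy g [h ->]; exists (fun j => \sum_i h i * P i j).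
  rewrite (eq_bigr (fun i => \sum_j h i * (P i j * x j))) => [|i _]; last first.
    by rewrite hy mulr_sumr.
  rewrite exchange_big; apply: eq_bigr => j _; rewrite mulr_suml.
  by apply: eq_bigr => i _; rewrite mulrA.
move=> hQ hfb g; split; first exact: (half Q).
apply: (half (invmx Q)) => i.
have : invmx Q *m (Q *m \col_j f j) = \col_j f j by rewrite mulKmx.
move=> /colP/(_ i); rewrite !mxE => <-; apply: eq_bigr => j _.
by rewrite mxE hfb; congr (_ * _); apply: eq_bigr => l _; rewrite mxE.
Qed.

End Generation.

Section Main.
Variables (K : fieldType) (S : smooth_data K).
Hypothesis hS : smooth_category S.
Variables n m k d : nat.
Variables (D : pred 'X_{1..n}) (al : 'I_k -> 'X_{1..n}).
Hypothesis hD : is_diagram D.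
Hypothesis hal : lists_vertices D al.
Hypothesis hd : is_ddeg D al d.
Local Notation R := (S (n + m)%N).
Variable f : 'I_k -> R.
Hypothesis hJ : forall s, (s <= d.+1)%N -> genJ D al f s \is a GRing.unit.
Hypothesis hJ0 : forall s, (s <= d.+1)%N -> genJ0 D al f s \is a GRing.unit.
Hypothesis hf : forall i, van (mdeg (al i)) (f i).
Local Notation cu := (mnm_pull (lshift m : 'I_n -> 'I_(n + m))).
Local Notation pu := (mnm_push (lshift m : 'I_n -> 'I_(n + m))).

Lemma vertex_deg i : (mdeg (al i) <= d)%N.
Proof.
have := @inB_deg n k d D al hd i 0%MM; rewrite addm0; apply.
apply/andP; split; first by apply/forallP=> t; rewrite mnm0E eqxx implybT.
by rewrite addm0; apply: (inDelta_al hal).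
Qed.

(** With a weight larger than all the degrees of vertices, a term that involves v
    never is of too low a degree. *)
Lemma van_wvan i : wvan d.+1 (mdeg (al i)) (f i).
Proof.
move=> c hc; have hi := vertex_deg i.
have hv : mdeg (mnm_pull (@rshift n m) c) = 0%N.
  by move: hc; rewrite /wdeg; case: (mdeg (mnm_pull (@rshift n m) c)) => // y; lia.
have ec : c = pu (cu c).
  move/eqP: hv; rewrite mdeg_eq0 => /eqP hv.
  by rewrite -{1}(uvK c) hv mnm_push0 addm0.
by rewrite ec; apply: hf; rewrite -(wdeg_pu m d.+1) -ec.
Qed.

Variables (q : 'I_k -> 'I_k -> R) (rmd : 'I_k -> R).
Hypothesis hqf : forall i, umon S m (al i) + rmd i = \sum_j q i j * f j.
Hypothesis hq : forall i j c, taylor (q i j) c != 0 -> inDelta al j (al j + cu c)%MM.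
Hypothesis hr : forall i c, taylor (rmd i) c != 0 -> ~~ D (cu c).

Lemma quotient_order w : (forall i, wvan w (mdeg (al i)) (f i)) ->
  forall i j c, (wdeg w c + mdeg (al j) < mdeg (al i))%N -> taylor (q i j) c = 0.
Proof.
move=> hfw i; apply: (division_unique hS hD hal hJ hfw (@hq i) (rmd := - rmd i)).
- by have := vertex_deg i; lia.
- by move=> c; rewrite (taylorN hS) oppr_eq0; apply: hr.
- by rewrite -hqf addrK; apply: wvan_umon.
Qed.

Lemma generator_order w : (forall i, wvan w (mdeg (al i)) (f i)) ->
  forall i, wvan w (mdeg (al i)) (umon S m (al i) + rmd i).
Proof.
move=> hfw i; rewrite hqf; apply: (wvan_sum hS) => j _.
apply: (@wvanW _ _ _ _ _ _ (mdeg (al i) - mdeg (al j) + mdeg (al j))); first lia.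
apply: (wvan_mul hS) => // c hc; apply: (quotient_order hfw); lia.
Qed.

Lemma generator_coef i : taylor (umon S m (al i) + rmd i) (pu (al i)) = 1.
Proof.
rewrite (taylor_add hS) -[taylor (umon _ _ _) _]/(uco _ _) (uco_umon hS) eqxx.
rewrite [X in _ + X](_ : _ = 0) ?addr0 //; apply/eqP; apply: contraT => /hr.
by rewrite mnm_pushK ?(vertex_diagram hal) //; apply: lshift_inj.
Qed.

(** A vector [v] with v (q_ij(0)) = 0 vanishes, by induction on the degree s of the
    vertices. The combination X of the vectors of lowest coefficients with weights
    v_i, |al_i| = s, vanishes at the vertices of degree s, and the matrix of J^s maps
    it to the combination of the unit vectors at those vertices with weights v_i.
    So its part outside the vertices is killed by the matrix of J^0_s, hence
    X = 0, and the v_i are 0. *)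
Lemma quotient_unit : (\matrix_(i, j) q i j) \in unitmx.
Proof.
have fw := van_wvan.
pose Q0 := map_mx (at0r hS (n:=_)) (\matrix_(i, j) q i j).
rewrite unitmxE (unit_at0 hS) -[at0 _]/(at0r hS _) -det_map_mx -/Q0.
have Q0E i j : Q0 i j = taylor (q i j) 0%MM by rewrite !mxE.
have Q00 i j : (mdeg (al j) < mdeg (al i))%N -> Q0 i j = 0.
  move=> hij; rewrite Q0E; apply: (quotient_order fw).
  by rewrite -(mnm_push0 (lshift m)) wdeg_pu mdeg0 add0n.
pose x i b := qvec al (q i) (0%MM : 'X_{1..m}) b.
have xal i j : x i (al j) = Q0 i j.
  rewrite /x (qvec1 _ _ (inDelta_al hal j)) Q0E; congr (taylor _ _).
  have -> : (al j - al j)%MM = 0%MM by apply/mnmP=> t; rewrite mnmBE subnn mnm0E.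
  by rewrite !mnm_push0 addm0.
have xeq i s (a : 'X_{1..n < s.+1}) : mdeg (al i) = s -> a \in Dset D s ->
    \sum_(b in Dset D s) jac0 al f a b * x i b = (al i == a)%:R.
  move=> hi; rewrite inE => /andP[hDa /eqP ha].
  have q_below j c : (wdeg d.+1 c + mdeg (al j) < s)%N -> taylor (q i j) c = 0.
    by rewrite -hi; apply: (quotient_order fw).
  have q_at_s j c : (wdeg d.+1 c + mdeg (al j) = s)%N ->
      (mdeg (mnm_pull (@rshift n m) c) < mdeg (0%MM : 'X_{1..m}))%N -> taylor (q i j) c = 0.
    by rewrite mdeg0.
  have hs0 : (s + d.+1 * mdeg (0%MM : 'X_{1..m}))%N = s by rewrite mdeg0 muln0 addn0.
  rewrite -(lowest_coef hS hD hal fw (@hq i) q_below q_at_s hs0 ha).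
  rewrite mnm_push0 addm0 -hqf (taylor_add hS) -[taylor (umon _ _ _) _]/(uco _ _) (uco_umon hS).
  rewrite [X in _ + X](_ : _ = 0) ?addr0 //; apply/eqP; apply: contraT => /hr.
  by rewrite mnm_pushK ?hDa //; apply: lshift_inj.
apply/negP => /det0P[v v0 hv]; case/eqP: v0; apply/rowP => i0; rewrite mxE.
suff main s i : (mdeg (al i) < s)%N -> v 0 i = 0 by apply: (main (mdeg (al i0)).+1).
elim: s i => // s IH i; rewrite ltnS leq_eqVlt => /orP[/eqP hi|]; last exact: IH.
pose X b := \sum_(j | mdeg (al j) == s) v 0 j * x j b.
have hs : (s <= d.+1)%N by rewrite -hi; have := vertex_deg i; lia.
have sumX (a : 'X_{1..n < s.+1}) : a \in Dset D s ->
    \sum_(b in Dset D s) jac0 al f a b * X b = \sum_(j | mdeg (al j) == s) v 0 j * (al j == a)%:R.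
  move=> ha; rewrite (eq_bigr (fun b : 'X_{1..n < s.+1} =>
      \sum_(j | mdeg (al j) == s) v 0 j * (jac0 al f a b * x j b))).
    rewrite exchange_big; apply: eq_bigr => j /eqP hj.
    by rewrite -mulr_sumr xeq.
  by move=> b _; rewrite mulr_sumr; apply: eq_bigr => j _; rewrite mulrCA.
have Xvert (b : 'X_{1..n < s.+1}) : b \in Vert D al s -> X b = 0.
  rewrite !inE => /andP[/andP[_ /eqP hb] /existsP[j /eqP ej]].
  have /rowP/(_ j) := hv; rewrite !mxE => <-.
  rewrite [RHS](bigID (fun i => mdeg (al i) == s)) /= [X in _ = _ + X]big1 ?addr0.
    by apply: eq_bigr => l _; rewrite -ej xal.
  move=> l hl; case: (ltngtP (mdeg (al l)) s) hl => // hl _; first by rewrite IH ?mul0r.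
  by rewrite Q00 ?mulr0 // ej hb.
have hai : (mdeg (al i) < s.+1)%N by rewrite hi.
have iD : BMultinom hai \in Dset D s by rewrite inE (vertex_diagram hal) /= hi eqxx.
have iV : BMultinom hai \in Vert D al s by rewrite inE iD; apply/existsP; exists i.
have D0 : Dset0 D al s = Dset D s :\: Vert D al s.
  by rewrite /Dset0 (_ : _ != _) //; apply/set0Pn; exists (BMultinom hai).
have X0 (b : 'X_{1..n < s.+1}) : b \in Dset D s -> X b = 0.
  move=> hb; case: (boolP (b \in Vert D al s)) => [|hbV]; first exact: Xvert.
  apply: (jac_inj hS (hJ0 hs)); last by rewrite D0 inE hbV.
  move=> a; rewrite D0 inE => /andP[haV haD].
  transitivity (\sum_(b in Dset D s) jac0 al f a b * X b).
    rewrite [RHS](bigID (fun b => b \in Vert D al s)) /= [X in _ = X + _]big1 ?add0r.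
      by apply: eq_bigl => c; rewrite inE andbC.
    by move=> c /andP[_ /Xvert ->]; rewrite mulr0.
  rewrite sumX // big1 // => j _; case: eqP => [e|]; last by rewrite mulr0.
  by case/negP: haV; rewrite inE haD; apply/existsP; exists j; apply/eqP.
have := sumX _ iD; rewrite big1 => [|b /X0 ->]; last by rewrite mulr0.
rewrite (bigD1 i) /=; last by rewrite hi.
rewrite eqxx mulr1 big1 ?addr0 => [<- //|j /andP[_ hji]].
by case: eqP => [/(vertex_inj hal) e|]; [rewrite e eqxx in hji|rewrite mulr0].
Qed.

End Main.

Theorem theorem5p3p4 (K : fieldType) (S : smooth_data K)
    (hS : smooth_category S) (n m k : nat)
    (D : pred 'X_{1..n}) (al : 'I_k -> 'X_{1..n}) (d : nat)
    (f : 'I_k -> S (n + m)%N)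
    (hD : is_diagram D) (hfin : finite_type D)
    (hal : lists_vertices D al) (hd : is_ddeg D al d)
    (hord : forall i, is_ord (restr (f i)) (mdeg (al i)))
    (hJ : forall s, (s <= d.+1)%N -> genJ D al f s \is a GRing.unit)
    (hJ0 : forall s, (s <= d.+1)%N -> genJ0 D al f s \is a GRing.unit) :
  exists fb : 'I_k -> S (n + m)%N,
    (forall g, ideal_gen fb g <-> ideal_gen f g) /\
    (forall i, exists r : S (n + m)%N,
       [/\ fb i = umon S m (al i) + r,
           normal_form D r
         & forall g, supd r g -> ~~ D (mnm_pull (lshift m) g)]) /\
    (forall i, is_ord (restr (fb i)) (mdeg (al i))) /\
    ((forall i, is_ord (f i) (mdeg (al i))) ->
       forall i, is_ord (fb i) (mdeg (al i))).
Proof.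
have hf i : van (mdeg (al i)) (f i).
  by move=> a ha; rewrite -(uco_restr hS); apply: (is_ordE hS (hord i)).
have [q0 [rmd hqr]] : exists (q : 'I_k -> 'I_k -> S (n + m)%N) (rmd : 'I_k -> S (n + m)%N),
  forall i,
    [/\ - umon S m (al i) = \sum_j q i j * f j + rmd i,
      forall j c, hasse c (q i j) <> 0 -> inDelta al j (al j + mnm_pull (lshift m) c)%MM,
      normal_form D (rmd i)
    & forall c, hasse c (rmd i) <> 0 -> ~~ D (mnm_pull (lshift m) c)].
  have h (i : 'I_k) := division hS hD hal hd hf hJ
    (leq_ltn_trans (leq0n i) (ltn_ord i)) (- umon S m (al i)).
  have [q hq] := fin_all_exists h; have [r hr] := fin_all_exists hq.
  by exists q, r.
pose q i j := - q0 i j.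
have tay0 c (F : S (n + m)%N) : taylor F c != 0 -> hasse c F <> 0.
  by move=> h e; rewrite (taylorE hS) e (at0_0 hS) eqxx in h.
have hqf i : umon S m (al i) + rmd i = \sum_j q i j * f j.
  have [e _ _ _] := hqr i; rewrite -[umon _ _ _]opprK e opprD -addrA addNr addr0 -sumrN.
  by apply: eq_bigr => j _; rewrite mulNr.
have hq i j c : taylor (q i j) c != 0 -> inDelta al j (al j + mnm_pull (lshift m) c)%MM.
  rewrite (taylorN hS) oppr_eq0 => /tay0 h; have [_ hh _ _] := hqr i; exact: hh h.
have hr i c : taylor (rmd i) c != 0 -> ~~ D (mnm_pull (lshift m) c).
  by move=> /tay0 h; have [_ _ _ hh] := hqr i; exact: hh h.
exists (fun i => umon S m (al i) + rmd i); split; [|split; [|split]].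
- apply: (ideal_gen_unitmx (quotient_unit hS hD hal hd hJ hJ0 hf hqf hq hr)) => i.
  by rewrite hqf; apply: eq_bigr => j _; rewrite mxE.
- by move=> i; exists (rmd i); have [_ _ h1 h2] := hqr i; split.
- move=> i; apply: (is_ordI hS (a := al i)) => // [b hb|]; rewrite (uco_restr hS).
    apply: (generator_order hS hD hal hd hJ hqf hq hr (van_wvan hal hd hf)).
    by rewrite wdeg_pu.
  by rewrite [uco _ _](generator_coef hS hal hr) oner_neq0.
move=> hford i; apply: (is_ordI hS (a := mnm_push (lshift m) (al i))) => [b hb||].
- apply: (generator_order hS hD hal hd hJ hqf hq hr (w := 1)); last by rewrite wdeg1.
  by move=> j c; rewrite wdeg1; apply: (is_ordE hS (hford j)).
- by rewrite mdeg_push.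
by rewrite (generator_coef hS hal hr) oner_neq0.
Qed.
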